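(* Let $\mu$ be a permuton satisfying $\widetilde{\mathrm{LIS}}_r(\mu)=1$ for some $r\in\mathbb{N}^*$. Then for all $1\le k\le r$, for (Lebesgue-)almost every $(x,y)\in(0,1)^2$, $\widetilde\lambda_k^\mu$ is differentiable at $(x,y)$ and satisfies $$\partial_x\widetilde\lambda_k^\mu(x,y)\cdot\partial_y\widetilde\lambda_k^\mu(x,y)=0.$$
   Context: $\mathbb{N}^*=\{1,2,\dots\}$. A permuton is a Borel probability measure on $[0,1]^2$ with both marginals uniform on $[0,1]$. A subset $A\subset[0,1]^2$ is nondecreasing if $(x_2-x_1)(y_2-y_1)\ge 0$ for all $(x_1,y_1),(x_2,y_2)\in A$, and $k$-nondecreasing if it is a union of $k$ nondecreasing subsets. For a finite Borel measure $\nu$ on $[0,1]^2$, $\widetilde{\mathrm{LIS}}_k(\nu):=\sup_A \nu(A)$ over closed $k$-nondecreasing $A\subset[0,1]^2$, $\widetilde{\mathrm{LIS}}_0(\nu):=0$. For $(x,y)\in[0,1]^2$, $\widetilde\lambda_k^\mu(x,y):=\widetilde{\mathrm{LIS}}_k(\mu|_{[0,x]\times[0,y]})-\widetilde{\mathrm{LIS}}_{k-1}(\mu|_{[0,x]\times[0,y]})$, where $\mu|_{[0,x]\times[0,y]}$ is the (unnormalized) restriction of $\mu$. *)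

(* Defs.v *)
From mathcomp Require Import all_boot all_order all_algebra.
From mathcomp Require Import all_classical all_reals all_analysis.
Set Implicit Arguments.
Unset Strict Implicit.
Unset Printing Implicit Defensive.
Import Order.TTheory GRing.Theory Num.Theory.
Import numFieldNormedType.Exports.
Local Open Scope classical_set_scope.
Local Open Scope ring_scope.

(* The product of the Borel sigma-algebras of R is the Borel sigma-algebra of
   the product topology, so measures on plane R are Borel measures on R^2. *)
Notation plane R := (measurableTypeR R * measurableTypeR R)%type.

Section Permutons.
Context {R : realType}.

Definition box (x y : R) : set (plane R) := `[0, x] `*` `[0, y].

Lemma measurable_box (x y : R) : measurable (box x y).
Proof. by apply: measurableX; exact: measurable_itv. Qed.

Definition unit_square : set (plane R) := box 1 1.

(* A Borel measure on the square is seen as a Borel measure on the plane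
   giving no mass to the complement of the square. *)
Definition is_permuton (mu : probability (plane R) R) : Prop :=
  [/\ mu (~` unit_square) = 0%E,
      forall B : set (measurableTypeR R), measurable B ->
        pushforward mu fst B = uniform_prob (@ltr01 R) B
    & forall B : set (measurableTypeR R), measurable B ->
        pushforward mu snd B = uniform_prob (@ltr01 R) B].

Definition nondecreasing_set (A : set (R * R)%type) : Prop :=
  forall p q : R * R, A p -> A q -> 0 <= (q.1 - p.1) * (q.2 - p.2).

Definition k_nondecreasing_set (k : nat) (A : set (R * R)%type) : Prop :=
  exists B : 'I_k -> set (R * R)%type,
    (forall i, nondecreasing_set (B i)) /\ A = \bigcup_i B i.

Definition LIS (k : nat) (nu : {finite_measure set (plane R) -> \bar R}) :
    \bar R :=
  if k is 0%N then 0%E else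
  ereal_sup [set nu A | A in
    [set A : set (R * R)%type |
      [/\ A `<=` unit_square, closed A & k_nondecreasing_set k A]]].

(* Used only for 1 <= k. The two suprema are finite because mu is. *)
Definition lambda (mu : probability (plane R) R) (k : nat) (p : R * R) : R :=
  let nu := mrestr mu (measurable_box p.1 p.2) in
  fine (LIS k nu) - fine (LIS k.-1 nu).

End Permutons.

(* Main.v *)
Require Import Defs.
From HB Require Import structures.
From mathcomp Require Import all_boot all_order all_algebra all_fingroup.
From mathcomp Require Import all_classical all_reals all_analysis.
From mathcomp Require Import measurable_realfun.
From mathcomp Require Import lra.
Set Implicit Arguments.
Unset Strict Implicit.
Unset Printing Implicit Defensive.
Import Order.TTheory GRing.Theory Num.Theory.
Import numFieldNormedType.Exports.
Local Open Scope classical_set_scope.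
Local Open Scope ring_scope.

(** Write V_k(x,y) for LIS_k of mu restricted to [0,x] x [0,y], so that
    lambda_k = V_k - V_(k-1), and M(x,y) = mu([0,x] x [0,y]).  All these functions
    are nondecreasing and 1-Lipschitz in each variable because mu has uniform
    marginals, hence differentiable almost everywhere.

    Fix x <= x' and y <= y'.  Uncrossing a union of k+1 chains in [0,x'] x [0,y']
    (minus the corner ]x,x'] x ]y,y']) with a union of k chains in [0,x] x [0,y]
    gives Fomin's growth rule as an inequality:
      V_(k+1)(x',y') + V_k(x,y) <= max (V_k(x',y) + V_(k+1)(x,y'),
                                        V_(k+1)(x',y) + V_k(x,y'))
                                   + mu(]x,x'] x ]y,y']).
    No chain meets both sides of the corner, which is why each chain can be put
    in one of the two families on the right.  The same uncrossing shows that
    lambda_k is nondecreasing in x and in y.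

    With x' = x + d and y' = y + d, the mass of the corner is o(d) wherever M is
    differentiable, so to first order the inequality reads
    min (d_x lambda_k, d_y lambda_k) <= 0, while both derivatives are >= 0. *)

(** * Exchanging chains *)

Section Exchange.
Variables (T : eqType) (le : rel T) (k : nat).
Hypotheses (le_refl : reflexive le) (le_trans : transitive le).

(** A partial labelling encodes [k] disjoint chains at once; [None] marks the points outside the
    family. *)
Definition chain_labelling (D : T -> Prop) (f : T -> option 'I_k) :=
  forall z w i, D z -> D w -> f z = Some i -> f w = Some i -> le z w || le w z.

(* The permutation [sg] pairs chain [i] of [L true] with chain [sg i] of
   [L false]; slot [i] of a new family is bounded by one chain of the pair. *)
Definition dominated (D : T -> Prop) (L : bool -> T -> option 'I_k)
    (sg : {perm 'I_k}) (d : bool) (i : 'I_k) (z : T) :=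
  exists w, [/\ D w, le z w & L d w = Some (if d then i else sg i)].

(** Counted with multiplicity, no point is lost; by inclusion-exclusion the total mass of the two
    families cannot drop. *)
Definition covers (L e : bool -> T -> option 'I_k) (z : T) :=
  (L true z && L false z -> e true z && e false z) /\
  (L true z || L false z -> e true z || e false z).

(* The points are swept in a linear extension of the order ([s] lists the last
   one first).  In each pair, [eps i] decides which new family continues chain
   [i] of [L true]; the other one continues its partner.  Only a point [z] lying
   on unpaired chains, of slots [i] and [j], is problematic, when the two chains
   are in the same new family: we then use the families obtained for
   [eps i := eps j] and swap the partners of [i] and [j], which is harmless as
   both chains now end at [z]. *)
Lemma exchange_seq (s : seq T) (L : bool -> T -> option 'I_k) :
    uniq s -> pairwise (fun z w => le z w ==> le w z) s ->
    (forall d, chain_labelling [in s] (L d)) ->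
  exists sg : {perm 'I_k}, forall eps : 'I_k -> bool,
  exists e : bool -> T -> option 'I_k,
  [/\ forall c, chain_labelling [in s] (e c),
      forall z, z \in s -> covers L e z
    & forall c z i, z \in s -> e c z = Some i ->
        dominated [in s] L sg (c == eps i) i z].
Proof.
elim: s => [_ _ _|z s IH].
  by exists 1%g => eps; exists (fun _ _ => None).
rewrite [uniq _]/= [pairwise _ _]/= => /andP[zs us] /andP[/allP zmax ps] chL.
have [//|//|d x y i xs ys|sg {}IH] := IH.
  by apply: chL; rewrite /= inE ?xs ?ys orbT.
(* As [z] is swept last, the earlier points on a chain through [z] all lie below it. *)
have Lz d w : w \in s -> L d z -> L d w = L d z -> le w z.
  move=> ws; case E : (L d z) => [i|//] _ Lw.
  have := chL d z w i; rewrite /= !inE eqxx ws orbT => /(_ isT isT E Lw).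
  by case/orP => // /(implyP (zmax _ ws)).
pose upd (f : T -> option 'I_k) v w := if w == z then v else f w.
have upd_s f v w : w \in s -> upd f v w = f w.
  by rewrite /upd; case: eqP => // ->; rewrite (negPf zs).
have upd_z f v : upd f v z = v by rewrite /upd eqxx.
have ch_upd f v : chain_labelling [in s] f ->
    (forall i w, v = Some i -> w \in s -> f w = Some i -> le w z) ->
    chain_labelling [in z :: s] (upd f v).
  move=> chf hv x y i /=; rewrite !inE.
  move=> /predU1P[->|xs] /predU1P[->|ys]; rewrite ?upd_z ?upd_s //.
  - by rewrite le_refl.
  - by move=> vi fy; rewrite (hv i y) ?orbT.
  - by move=> fx vi; rewrite (hv i x).
  - exact: chf.
have dom_cons d i (sg' : {perm 'I_k}) w : d || (sg' i == sg i) -> dominated [in s] L sg d i w ->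
    dominated [in z :: s] L sg' d i w.
  move=> dsg [x [xs wx Lx]]; exists x; split => //.
    by rewrite /= inE xs orbT.
  by case: d dsg Lx => //= /eqP ->.
have single d l : L d z = Some l -> L (~~ d) z = None ->
    exists sg : {perm 'I_k}, forall eps : 'I_k -> bool,
    exists e : bool -> T -> option 'I_k,
    [/\ forall c, chain_labelling [in z :: s] (e c),
      forall z0, z0 \in z :: s -> covers L e z0
    & forall c z0 i, z0 \in z :: s -> e c z0 = Some i ->
      dominated [in z :: s] L sg (c == eps i) i z0].
  move=> Ld Lnd; exists sg => eps; have [e [che cove dome]] := IH eps.
  pose i := if d then l else (sg^-1)%g l.
  have il : (if d then i else sg i) = l.
    by rewrite /i; case: (d) => //; rewrite permKV.
  have dE b : (d == b) == b = d by case: (d) b => -[].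
  (* [d == eps i] is the new family that continues the chain of [L d] in slot [i]. *)
  exists (fun c => upd (e c) (if c == (d == eps i) then Some i else None)).
  split=> [c|w|c w m].
  - apply: ch_upd => // m w; case: eqP => // -> [<-] ws ew.
    have [x [xs wx Lx]] := dome _ _ _ ws ew.
    apply: le_trans wx _; apply: (Lz d) => //; first by rewrite Ld.
    by move: Lx; rewrite dE il Ld.
  - rewrite inE => /predU1P[->|ws]; last first.
      by rewrite /covers !upd_s //; exact: cove.
    rewrite /covers !upd_z; split.
      by move: Ld Lnd; case: (d) => /= -> ->.
    by case: (d == _).
  - rewrite inE => /predU1P[->|ws].
      rewrite upd_z; case: eqP => // -> [<-].
      exists z; split; [by rewrite /= inE eqxx|exact: le_refl|].
      by rewrite dE il.
    rewrite upd_s // => ew; apply: dom_cons (dome _ _ _ ws ew).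
    by rewrite eqxx orbT.
case Lt : (L true z) => [i|]; case Lf : (L false z) => [l|].
(* [j] is the slot whose pair contains the chain [l] through [z]. It may equal [i], in which case
   the transposition is trivial. *)
- pose j := (sg^-1)%g l; have jl : sg j = l by rewrite permKV.
  exists (tperm i j * sg)%g => eps.
  pose eps0 x := if x == i then eps j else eps x.
  have eps0j : eps0 j = eps j by rewrite /eps0; case: eqP.
  have eps0i : eps0 i = eps j by rewrite /eps0 eqxx.
  have [e [che cove dome]] := IH eps0.
  (* With [eps0], the family other than [eps j] continues the chains of [L false] in both slots;
     exchanging its slots matches the new pairing. *)
  pose e' c w := if c == eps j then e c w else omap (tperm i j) (e c w).
  have e'E c w m : e' c w = Some m ->
      e c w = Some (if c == eps j then m else tperm i j m).
    rewrite /e'; case: eqP => // _.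
    by case: (e c w) => //= x [<-]; rewrite tpermK.
  have e'i c w : w \in s -> e' c w = Some i -> le w z.
    move=> ws /e'E ew; have [x [xs wx Lx]] := dome _ _ _ ws ew.
    apply: le_trans wx _; move: Lx; rewrite tpermL.
    have [cj|cj] := eqVneq c (eps j).
      by rewrite eps0i cj eqxx => Lx; apply: (Lz true); rewrite // ?Lt // Lx Lt.
    by rewrite eps0j (negPf cj) jl => Lx; apply: (Lz false); rewrite // ?Lf // Lx Lf.
  (* [z] lies on both chains of the new pair [i], so slot [i] is dominated whatever the value of
     [eps i]. *)
  have zself d : dominated [in z :: s] L (tperm i j * sg)%g d i z.
    exists z; split; [by rewrite /= inE eqxx|exact: le_refl|].
    by case: d; rewrite // permM tpermL jl.
  have domz w d : le w z -> dominated [in z :: s] L (tperm i j * sg)%g d i w.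
    by move=> wz; have [x [xs zx Lx]] := zself d; exists x; split => //;
       exact: le_trans wz zx.
  exists (fun c => upd (e' c) (Some i)); split=> [c|w|c w m].
  - apply: ch_upd => [x y m xs ys /e'E ex /e'E ey|_ w [<-]]; last exact: e'i.
    exact: che xs ys ex ey.
  - rewrite inE => /predU1P[->|ws]; first by rewrite /covers !upd_z.
    have [h1 h2] := cove _ ws; rewrite /covers !upd_s // /e'.
    have isS (b : bool) (v : option 'I_k) :
      (if b then v else omap (tperm i j) v) = v :> bool by case: b v => -[].
    by rewrite !isS.
  - rewrite inE => /predU1P[->|ws]; first by rewrite upd_z => -[<-].
    rewrite upd_s // => ew.
    have [mi|mi] := eqVneq m i.
      by subst m; apply: domz; exact: e'i ew.
    move/e'E : ew; have [cj|cj] := eqVneq c (eps j).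
      move=> /(dome _ _ _ ws); rewrite {1}/eps0 (negPf mi) => h.
      have [mj|mj] := eqVneq m j.
        by move: h; rewrite mj cj eqxx => h; apply: (dom_cons _ _ _ _ _ h).
      apply: (dom_cons _ _ _ _ _ h).
      by rewrite permM tpermD ?eqxx ?orbT // eq_sym.
    have [mj|mj] := eqVneq m j.
      subst m; rewrite tpermR => /(dome _ _ _ ws).
      rewrite eps0i (negPf cj) => -[x [xs wx Lx]]; exists x; split=> //.
        by rewrite /= inE xs orbT.
      by rewrite permM tpermR.
    have tm : tperm i j m = m by rewrite tpermD // eq_sym.
    rewrite tm => /(dome _ _ _ ws).
    rewrite {1}/eps0 (negPf mi) => h; apply: (dom_cons _ _ _ _ _ h).
    by rewrite permM tm eqxx orbT.
- exact: (single true i).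
- exact: (single false l).
- exists sg => eps; have [e [che cove dome]] := IH eps.
  exists (fun c => upd (e c) None); split=> [c|w|c w m].
  - exact: ch_upd.
  - rewrite inE => /predU1P[->|ws]; first by rewrite /covers Lt Lf.
    by rewrite /covers !upd_s //; exact: cove.
  - rewrite inE => /predU1P[->|ws]; first by rewrite upd_z.
    rewrite upd_s // => /(dome _ _ _ ws); apply: dom_cons.
    by rewrite eqxx orbT.
Qed.
End Exchange.

(** * Exchange for infinitely many points *)

Section ExchangeInf.
Variables (T : choiceType) (le tot : rel T) (k : nat).
Hypotheses (le_refl : reflexive le) (le_trans : transitive le).
Hypotheses (tot_total : total tot) (tot_trans : transitive tot).
Hypothesis tot_le : forall z w, le z w -> tot w z -> le w z.

(** Otherwise the ultrafilter would contain the complement of each of the finitely many fibres,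
    hence their empty intersection. *)
Lemma ultra_finType (I : Type) (V : finType) (G : set_system I) (g : I -> V) :
  UltraFilter G -> exists v, \forall s \near G, g s = v.
Proof.
move=> UG; apply: contrapT => h.
have {}h v : \forall s \near G, g s <> v.
  have [//|hv] := in_ultra_setVsetC [set s | g s <> v] UG.
  exfalso; apply: h; exists v; apply: filterS hv => s /=; exact: contrapT.
have [s] : exists s, forall v, g s <> v.
  by apply: (@filter_ex _ G); apply: filter_forall.

by move/(_ (g s)).
Qed.

(* The labels of the points range over finite sets and every requirement concerns
   at most two points, so an ultrafilter on the finite sequences of points yields
   the infinite case. *)
Lemma exchange (L : bool -> T -> option 'I_k) (eps : 'I_k -> bool) :
    (forall d, chain_labelling le setT (L d)) ->
  exists (sg : {perm 'I_k}) (e : bool -> T -> option 'I_k),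
  [/\ forall c, chain_labelling le setT (e c),
      forall z, covers L e z
    & forall c z i, e c z = Some i ->
      let d := c == eps i in let l := if d then i else sg i in
      (exists w, L d w = Some l) /\
      forall u, (forall w, L d w = Some l -> le w u) -> le z u].
Proof.
move=> chL.
have fin (s : seq T) : exists x : {perm 'I_k} * (bool -> T -> option 'I_k),
  [/\ forall c, chain_labelling le [in s] (x.2 c),
      forall z, z \in s -> covers L x.2 z
    & forall c z i, z \in s -> x.2 c z = Some i ->
        dominated le [in s] L x.1 (c == eps i) i z].
  (* Decreasing [tot] lists the points from the top, as the sweep requires. *)
  pose s' := sort (fun z w => tot w z) (undup s).
  have ss' : s =i s' by move=> x; rewrite mem_sort mem_undup.
  have [||d x y i xs ys|sg /(_ eps)[e [h1 h2 h3]]] := @exchange_seq T le k le_refl le_trans s' L.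
  - by rewrite sort_uniq undup_uniq.
  - apply: (@sub_pairwise _ (fun z w => tot w z)) => [z w wz|].
      by apply/implyP => zw; exact: tot_le.
    rewrite -sorted_pairwise; last by move=> x y z xy yz; exact: tot_trans yz xy.
    by apply: sort_sorted => x y; rewrite orbC.
  - exact: chL.
  exists (sg, e); split => [c x y i xs ys|x xs|c x i xs ex].
  - by apply: h1; rewrite /= -ss'.
  - by apply: h2; rewrite -ss'.
  - have [|w [ws xw Lw]] := h3 c x i _ ex; first by rewrite -ss'.
    by exists w; split => //=; rewrite ss'.
have [E hE] := choice fin.
(* A property holds along [F] when it holds for all large enough finite sequences, so each given
   point is eventually listed. *)
pose F : set_system (seq T) :=
  [set P | exists s0 : seq T, forall s, {subset s0 <= s} -> P s].
have FF : ProperFilter F.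
  split; first by move=> [s0 /(_ s0)]; exact.
  split=> [|P Q [s hs] [t ht]|P Q PQ [s hs]]; first by exists [::].
    exists (s ++ t) => u su; split; [apply: hs|apply: ht] => x xs;
      by apply: su; rewrite mem_cat xs ?orbT.
  by exists s => u /hs /PQ.
have [G [UG FG]] := ultraFilterLemma FF.
have near_in z : \forall s \near G, z \in s.
  by apply: FG; exists [:: z] => s; apply; rewrite inE.
have [sg hsg] := ultra_finType (fun s => (E s).1) UG.
have /choice[e he] (cz : bool * T) : exists v, \forall s \near G, (E s).2 cz.1 cz.2 = v.
  exact: (ultra_finType (fun s => (E s).2 cz.1 cz.2) UG).
have {}he c z : \forall s \near G, (E s).2 c z = e (c, z) by exact: (he (c, z)).
exists sg, (fun c z => e (c, z)); split=> [c z w i _ _ ez ew|z|c z i ez].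
- have [s [[zs ws] [Ez Ew]]] := filter_ex
    (filterI (filterI (near_in z) (near_in w)) (filterI (he c z) (he c w))).
  have [h _ _] := hE s; apply: (h c z w i) => //; congruence.
- have [s [zs [Et Ef]]] := filter_ex
    (filterI (near_in z) (filterI (he true z) (he false z))).
  by have [_ /(_ z zs) h _] := hE s; rewrite /covers -Et -Ef.
- have [s [zs [Es Ez]]] := filter_ex (filterI (near_in z) (filterI hsg (he c z))).
  have [_ _ /(_ c z i zs)] := hE s; rewrite Ez ez Es => /(_ erefl).
  move=> [w [ws zw Lw]] /=; split; first by exists w.
  by move=> u hu; apply: le_trans zw _; exact: hu.
Qed.
End ExchangeInf.

(** * Exchange in the plane *)

Section PlanarExchange.
Context {R : realType}.
Implicit Types p q : R * R.

Definition lep p q := (p.1 <= q.1) && (p.2 <= q.2).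

Lemma lep_nondecreasing p q : 0 <= (q.1 - p.1) * (q.2 - p.2) <-> lep p q || lep q p.
Proof.
rewrite /lep; split; last by move/orP => [] /andP[*]; nra.
case: (ltgtP p.1 q.1) (ltgtP p.2 q.2) => [h|h|h] [h'|h'|h'] //=; nra.
Qed.

(* A chain leaving the lower left quadrant of [(x, y)] does so for good, on one
   side only, so [eps] can send it to the right or to the upper family; its
   points outside the quadrant are above every point of its slot. *)
Lemma planar_exchange (k : nat) (A B : 'I_k -> set (R * R)) (x y : R)
    (eps : 'I_k -> bool) :
    (forall i, nondecreasing_set (A i)) -> (forall i, nondecreasing_set (B i)) ->
    (forall i p, B i p -> p.1 <= x /\ p.2 <= y) ->
    (forall i p, A i p -> p.1 <= x \/ p.2 <= y) ->
    (forall i p, A i p -> x < p.1 -> eps i) ->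
    (forall i p, A i p -> y < p.2 -> ~~ eps i) ->
  exists (sg : {perm 'I_k}) (E : bool -> 'I_k -> set (R * R)),
  [/\ forall c i, nondecreasing_set (E c i),
      ((\bigcup_i A i) `&` \bigcup_i B i) `<=`
        (\bigcup_i E true i) `&` \bigcup_i E false i,
      ((\bigcup_i A i) `|` \bigcup_i B i) `<=`
        (\bigcup_i E true i) `|` \bigcup_i E false i,
      forall c i p, E c i p -> ((\bigcup_i A i) `|` \bigcup_i B i) p /\
        (if c then p.2 <= y else p.1 <= x)
    & forall c i, (if c == eps i then A i else B (sg i)) = set0 -> E c i = set0].
Proof.
move=> ndA ndB DB DA epsR epsT.
pose a z := [pick i | `[<A i z>]]; pose b z := [pick i | `[<B i z>]].
have aP z i : a z = Some i -> A i z.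
  by rewrite /a; case: pickP => // j /asboolP Aj [<-].
have bP z i : b z = Some i -> B i z.
  by rewrite /b; case: pickP => // j /asboolP Aj [<-].
have aS z i : A i z -> exists j, a z = Some j.
  by rewrite /a; case: pickP => [j|/(_ i)/asboolP//]; exists j.
have bS z i : B i z -> exists j, b z = Some j.
  by rewrite /b; case: pickP => [j|/(_ i)/asboolP//]; exists j.
(* Only the part of [A] inside the quadrant is exchanged, so every slot is bounded by [(x, y)]; the
   rest is attached afterwards, in [E]. *)
pose D z := (z.1 <= x) && (z.2 <= y).
pose L (d : bool) z := if d then if D z then a z else None else b z.
have LD d l w : L d w = Some l -> lep w (x, y).
  rewrite /lep /L; case: d; first by rewrite /D; case: ifP.
  by move/bP/DB => /= -[-> ->].
(* The coordinate sum linearises the product order: comparable points whose sums are in the reverse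
   order coincide. *)
have [||||||sg [e [che cove dome]]] :=
  @exchange (R * R)%type lep (fun p q => p.1 + p.2 <= q.1 + q.2) k _ _ _ _ _ L eps.
- by move=> p; rewrite /lep !lexx.
- by move=> p q r /andP[h1 h2] /andP[h3 h4]; rewrite /lep !(le_trans h1, le_trans h2).
- by move=> p q; exact: le_total.
- by move=> p q r; exact: le_trans.
- by move=> p q /andP[h1 h2] h; rewrite /lep; apply/andP; split; lra.
- move=> d p q i _ _ Lp Lq; apply/lep_nondecreasing; move: Lp Lq; case: d => /=.
    by case: ifP; case: ifP => // _ _ /aP Ap /aP; exact: ndA Ap.
  by move=> /bP Bp /bP; exact: ndB Bp.
pose U := (\bigcup_i A i) `|` \bigcup_i B i.
pose E (c : bool) (i : 'I_k) := [set z | U z /\ (e c z = Some i \/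
  (a z = Some i /\ if c then x < z.1 else y < z.2))].
have AU i z : A i z -> U z by move=> Az; left; exists i.
have BU i z : B i z -> U z by move=> Az; right; exists i.
exists sg, E; split.
- move=> c i.
  (* If [A i] leaves the quadrant on side [c], then [eps] makes slot [i] of family [c] continue
     [A i]; its points are thus dominated by points of [A i] in the quadrant, all below [w]. *)
  have mixed z w : e c z = Some i -> A i w -> (if c then x < w.1 else y < w.2) -> lep z w.
    move=> ez Aw wc.
    have [_ h] := dome _ _ _ ez; apply: h => v.
    have -> : c == eps i.
      by case: (c) wc => [/(epsR _ _ Aw)->//|/(epsT _ _ Aw)/negPf ->].
    rewrite /L /D; case: ifP => // /andP[vx vy] /aP Av.
    move: (ndA _ _ _ Av Aw) => {}h; rewrite /lep.
    have [wx|wx] := lerP w.1 x; have [wy|wy] := lerP w.2 y;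
      by case: (c) wc => wc; apply/andP; split; nra.
  move=> z w [_ [ez|[/aP az zc]]] [_ [ew|[/aP aw wc]]].
  + by apply/lep_nondecreasing; exact: che ez ew.
  + by apply/lep_nondecreasing; rewrite (mixed z w).
  + by apply/lep_nondecreasing; rewrite (mixed w z) ?orbT.
  + exact: ndA az aw.
- move=> z [[i _ Az] [j _ Bz]].
  have [h _] := cove z; have [i' Ai'] := aS _ _ Az; have [j' Bj'] := bS _ _ Bz.
  have Dz : D z by apply/andP; exact: (DB _ _ Bz).
  move: h; rewrite /L Dz Ai' Bj' => /(_ isT).
  case Et : (e true z) => [m|//]; case Ef : (e false z) => [n|//] _.
  by split; [exists m|exists n] => //; split; [exact: (AU i)|left|exact: (AU i)|left].
- move=> z Uz; have [_ h] := cove z.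
  have ee : e true z || e false z ->
      ((\bigcup_i E true i) `|` \bigcup_i E false i) z.
    case Et : (e true z) => [m|].
      by move=> _; left; exists m => //; split => //; left.
    case Ef : (e false z) => [m|//] _.
    by right; exists m => //; split => //; left.
  case: (Uz) => -[i _ Az].
    have [j aj] := aS _ _ Az.
    have [Dz|] := boolP (D z).
      by apply/ee/h; rewrite /L Dz aj.
    rewrite /D negb_and -!ltNge => /orP[xz|yz].
      by left; exists j => //; split => //; right.
    by right; exists j => //; split => //; right.
  by have [j bj] := bS _ _ Az; apply/ee/h; rewrite /L bj orbT.
- move=> c i z [Uz h]; split => //; case: h => [ez|[/aP Az]].
    have [_ /(_ (x, y))] := dome _ _ _ ez.
    move/(_ (fun w => @LD _ _ w)) => /andP[/= ? ?]; by case: (c).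
  have /= := DA _ _ Az.
  by case: (c) => -[]// h1 h2; move: (lt_le_trans h2 h1); rewrite ltxx.
- move=> c i h; apply/seteqP; split => // z [_ []].
    move=> /dome[[w Lw] _]; move: Lw h; case: eqP => _ /=.
      by case: ifP => // _ /aP Aw h; rewrite h in Aw.
    by move/bP => Bw h; rewrite h in Bw.
  move=> [/aP az zc]; move: h.
  have -> : c == eps i.
    by case: (c) zc => [/(epsR _ _ az)->//|/(epsT _ _ az)/negPf ->].
  by move=> h; rewrite h in az.
Qed.
End PlanarExchange.

(** * Almost everywhere differentiability *)

Section Monotone1D.
Context {R : realType}.
Local Notation leb := (@lebesgue_measure R).

Lemma continuous_nondecreasing_nonexpansive (g : R -> R) :
  (forall x y, x <= y -> g x <= g y <= g x + (y - x)) -> continuous g.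
Proof.
move=> hg x; apply/cvgrPdist_le => e e0; near=> y.
have : `|x - y| <= e by near: y; exact: cvgr_dist_le.
have [xy|/ltW xy] := leP x y.
  have /andP[h1 h2] := hg _ _ xy.
  by rewrite !ler0_norm ?subr_le0//; lra.
have /andP[h1 h2] := hg _ _ xy.
by rewrite !ger0_norm ?subr_ge0//; lra.
Unshelve. all: by end_near. Qed.

Lemma lebesgue_stieltjes_measure_itvoc (G : cumulative R R) (a b : R) : a <= b ->
  lebesgue_stieltjes_measure G `]a, b]%classic = (G b - G a)%:E.
Proof.
move=> ab; rewrite /lebesgue_stieltjes_measure /measure_extension.
by rewrite measurable_mu_extE/= ?wlength_itv_bnd//; exact: is_ocitv.
Qed.

(* The Lebesgue-Stieltjes measure of [g] is at most the Lebesgue measure, so it has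
   a density, and the Lebesgue differentiation theorem applies. *)
Lemma ae_derivable_nondecreasing_nonexpansive (g : R -> R) :
  (forall x y, x <= y -> g x <= g y <= g x + (y - x)) ->
  {ae leb, forall x, derivable g x 1}.
Proof.
move=> hg.
have gnd : {homo g : x y / x <= y} by move=> x y /hg/andP[].
have grc : right_continuous g.
  by apply: right_continuousW; exact: continuous_nondecreasing_nonexpansive.
pose G : cumulative R R := HB.pack g (isCumulative.Build R _ R g gnd grc).
pose nu := lebesgue_stieltjes_measure G.
have nu_itv (a b : R) : a <= b -> nu `]a, b]%classic = (g b - g a)%:E.
  exact: lebesgue_stieltjes_measure_itvoc.
have nu_leb (A : set (measurableTypeR R)) : (nu A <= leb A)%E.
  (* Both are outer measures over the same covers, and each half-open interval has Stieltjes length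
     at most its Lebesgue length. *)
  rewrite /nu /lebesgue_measure/= /lebesgue_stieltjes_measure/= /measure_extension/=.
  rewrite /mu_ext; apply: le_ereal_inf_tmp => _ [F [mF AF] <-].
  apply: (@le_trans _ _ (\sum_(k <oo) wlength G (F k))%E).
    by apply: ereal_inf_lbound; exists F.
  apply: lee_nneseries => [k _ _|k _]; first exact: wlength_ge0.
  have [[a b] _ <-] := mF k.
  rewrite /=; have [ab|ba] := leP a b; last first. 
    by rewrite set_itv_ge ?wlength0 // -leNgt bnd_simp ltW.
  rewrite !wlength_itv_bnd// lee_fin.
  by have /andP[] := hg _ _ ab; rewrite /=; lra.
(* On a bounded window the Stieltjes measure is finite, so its density is integrable. *)
pose D n : set (measurableTypeR R) := `]- n%:R, n%:R]%classic.
have mD n : measurable (D n) by exact: measurable_itv.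
have nuD n : (nu (D n) < +oo)%E.
  by rewrite nu_itv ?ltry//; have := ler0n R n; lra.
suff key n : {ae leb, forall x, - n%:R < x < n%:R -> derivable g x 1}.
  have := ae_foralln key.
  apply: (@filterS _ _ (ae_filter_ringOfSetsType leb)) => x hx.
  by apply: (hx (Num.bound `|x|)); rewrite -ltr_norml archi_boundP.
pose nun : {finite_measure set (measurableTypeR R) -> \bar R} := mfrestr (mD n) (nuD n).
have dom : nun `<< leb.
  apply/null_content_dominatesP => A mA A0; apply/eqP.
  rewrite eq_le measure_ge0 andbT -A0 (le_trans _ (nu_leb A))//.
  by rewrite /nun/= /mfrestr/= /mrestr le_measure ?inE//; exact: measurableI.
have [f [f0 ffin intf fE]] := radon_nikodym_sigma_finite dom.
pose h := fine \o f.
have hf : EFin \o h = f by apply/funext => x; rewrite /h /= fineK.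
have inth : leb.-integrable setT (EFin \o h) by rewrite hf.
have := @FTC1 R h (BRight (- n%:R)) _ (open_integrable_locally openT inth).
have intS (y : R) : leb.-integrable `]- n%:R, y]%classic (EFin \o h).
  by apply: integrableS inth => //; exact: measurable_itv.
move=> /(_ intS).
apply: (@filterS _ _ (ae_filter_ringOfSetsType leb)) => x hx /andP[nx xn].
have [//|dF _] := hx _.
(* Inside the window [g] is the primitive of [h] plus the constant [g (- n%:R)]. *)
have := derivableD dF (derivable_cst (g (- n%:R)) x 1).
apply: near_eq_derivable; near=> y.
have ny : - n%:R < y by near: y; exact: lt_nbhsr.
have yn : y < n%:R by near: y; exact: lt_nbhsl.
rewrite /= [in LHS]/GRing.add/= /Rintegral.
have := fE `]- n%:R, y]%classic (measurable_itv _).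
rewrite -hf => <-.
rewrite /nun/= /mfrestr/= /mrestr setIidl.
  by rewrite lebesgue_stieltjes_measure_itvoc ?(ltW ny)//= subrK.
by move=> z; rewrite /D /= !in_itv/= => /andP[->] /le_trans; apply; exact: ltW.
Unshelve. all: by end_near. Qed.
End Monotone1D.

(** The differential is picked by choice, so any continuous linear map with a small remainder serves
    as a witness. *)
Lemma differentiable_expansion (R : realType) (V W : normedModType R) (f : V -> W)
    (df : {linear V -> W}) (x : V) : continuous df ->
  (forall e, 0 < e -> \forall y \near x, `|f y - (f x + df (y - x))| <= e * `|y - x|) ->
  differentiable f x.
Proof.
move=> dfc dxf; apply/diffP => /=.
apply: (@getPex _ (fun (df : {linear V -> W}) => continuous df /\
  forall y, f y = f (lim (nbhs x)) + df (y - lim (nbhs x))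
                  +o_(y \near x) (y - lim (nbhs x)))).
exists df; split => //; rewrite lim_id //.
apply/(@eqaddoEx _ _ _ _ _ _ _ (fun y => f y - (f x + df (y - x)))) => y.
by rewrite littleoE //= addrC subrK.
Qed.

Section LinearForm.
Context {R : realType}.
Definition linear_form (a b : R) (q : R * R) := a * q.1 + b * q.2.

Lemma linear_form_is_linear (a b : R) : linear (linear_form a b).
Proof.
by move=> k p q; rewrite /linear_form /= /GRing.scale/=; lra.
Qed.
HB.instance Definition _ (a b : R) := GRing.isLinear.Build R (R * R)%type R _
  (linear_form a b) (linear_form_is_linear a b).

Lemma continuous_linear_form (a b : R) : continuous (linear_form a b).
Proof.
move=> p; apply: cvgD; apply: cvgM; try exact: cvg_cst.
  exact: cvg_fst.
exact: cvg_snd.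
Qed.

Lemma differentiable_linear_form (f : R * R -> R) (p : R * R) (a b : R) :
  (forall e, 0 < e -> \forall h \near (0 : R * R),
    `|f (p + h) - f p - linear_form a b h| <= e * (`|h.1| + `|h.2|)) ->
  differentiable f p.
Proof.
move=> H; apply: (@differentiable_expansion _ _ _ _ (linear_form a b)).
  exact: continuous_linear_form.
move=> e e0.
rewrite (near_shift 0 p) /=.
(* The norm of the product is the maximum of the coordinates, and their sum is at most twice it. *)
have e2 : 0 < e / 2 by lra.
near=> h.
have : `|f (p + h) - f p - linear_form a b h| <= e / 2 * (`|h.1| + `|h.2|).
  by near: h; exact: H.
rewrite /= subr0 [in f _]addrC addrK.
set l := linear_form a b h; rewrite [_ - (f p + l)](_ : _ = f (h + p) - f p - l); last by lra.
move=> /le_trans; apply.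
rewrite -mulrA ler_pM2l //.
have -> : `|h| = Num.max `|h.1| `|h.2| by [].
have h1 : `|h.1| <= Num.max `|h.1| `|h.2| by rewrite le_max lexx.
have h2 : `|h.2| <= Num.max `|h.1| `|h.2| by rewrite le_max lexx orbT.
lra.
Unshelve. all: by end_near. Qed.
End LinearForm.

(** * Borel sets, null sets and porosity in the plane *)

Section PlaneMeasure.
Context {R : realType}.
Local Notation leb := (@lebesgue_measure R).

(** An open set is the countable union of the rational rectangles it contains. *)
Lemma open_measurable_plane (U : set (R * R)) :
  open U -> measurable (U : set (plane R)).
Proof.
move=> oU.
pose Q (a b c d : rat) : set (plane R) :=
  `]ratr a, ratr b[%classic `*` `]ratr c, ratr d[%classic.
pose F a b c d := if `[< Q a b c d `<=` U >] then Q a b c d else set0.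
have -> : U = \bigcup_a \bigcup_b \bigcup_c \bigcup_d F a b c d.
  apply/seteqP; split=> [p Up|p]; last first.
    by move=> [a _ [b _ [c _ [d _]]]]; rewrite /F; case: asboolP => // + Qp; exact.
  have : nbhs p U by exact: open_nbhs_nbhs.
  move=> /nbhs_ballP[e /= e0 eU].
  have rin (x y : R) : x < y -> exists q : rat, x < ratr q < y.
    by move=> /rat_in_itvoo[q]; rewrite in_itv; exists q.
  have [a /andP[a1 a2]] : exists q : rat, p.1 - e < ratr q < p.1 by apply: rin; lra.
  have [b /andP[b1 b2]] : exists q : rat, p.1 < ratr q < p.1 + e by apply: rin; lra.
  have [c /andP[c1 c2]] : exists q : rat, p.2 - e < ratr q < p.2 by apply: rin; lra.
  have [d /andP[d1 d2]] : exists q : rat, p.2 < ratr q < p.2 + e by apply: rin; lra.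
  exists a => //; exists b => //; exists c => //; exists d => //.
  rewrite /F asboolT; first by split; rewrite /= in_itv/=; apply/andP.
  move=> q [/=]; rewrite !in_itv/= => /andP[q1 q2] /andP[q3 q4]; apply: eU.
  by split; rewrite /ball/= ltr_norml; apply/andP; split; lra.
do 4![apply: bigcupT_measurable_rat => ?]; rewrite /F; case: ifP => // _.
by apply: measurableX; exact: measurable_itv.
Qed.

Lemma closed_measurable_plane (C : set (R * R)) :
  closed C -> measurable (C : set (plane R)).
Proof.
move=> cC; rewrite -[C]setCK; apply: measurableC.
by apply: open_measurable_plane; exact: closed_openC.
Qed.

Lemma product_null_xsection (N : set (plane R)) : measurable N ->
  (forall x, leb (xsection N x) = 0%E) -> (leb \x leb)%E N = 0%E.
Proof. by move=> mN N0; apply: integral0_eq => x _; exact: N0. Qed.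

Lemma product_null_ysection (N : set (plane R)) : measurable N ->
  (forall y, leb (ysection N y) = 0%E) -> (leb \x leb)%E N = 0%E.
Proof.
move=> mN N0.
rewrite (@product_measure_unique _ _ _ _ _ _ _ (leb \x^ leb)%E) //.
  by apply: integral0_eq => x _; exact: N0.
by move=> A B mA mB; rewrite /= product_measure2E.
Qed.

(** The tube lemma for a compact segment of parameters; it makes the porosity conditions, which
    quantify over all [t], measurable. *)
Lemma tube_open (C : set (R * R)) (g : R * R -> R -> R * R) :
  closed C -> continuous (fun z : (R * R) * R => g z.1 z.2) ->
  open [set p | forall t, -1 <= t <= 1 -> ~ C (g p t)].
Proof.
move=> cC cg; rewrite openE => p /= Hp.
have cK : compact `[-1 : R, 1]%classic by exact: segment_compact.
have /compact_near_coveringP/(_ (R * R)%type (nbhs p) (fun q t => ~ C (g q t))) := cK.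
case=> [t|A A' AA' ].
  rewrite /= in_itv/= => tK.
  have nC : nbhs (g p t) (~` C).
    by apply: open_nbhs_nbhs; split; [exact: closed_openC|exact: Hp].
  have [[A B] /= [nA nB] AB] := cg (p, t) _ nC.
  by exists (B, A) => //= -[t' q] [/= Bt Aq]; exact: (AB (q, t')).
by exists A => // q /AA' h t tt; apply: h; rewrite /= in_itv.
Qed.

(** A hole of radius [eta * |h|] around [x + h] lies in the ball of radius [2 * |h|] around [x] and
    fills a fraction [eta / 2] of it. At a density point the density exceeds [1 - eta / 2] at small
    scales, which excludes such holes. *)
Lemma ae_not_porous (E : set (measurableTypeR R)) (eta : R) :
  measurable E -> 0 < eta <= 1 ->
  {ae leb, forall x, E x -> exists2 delta, 0 < delta &
    forall h, 0 < `|h| < delta ->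
      exists2 t, -1 <= t <= 1 & E (x + h + eta * h * t)}.
Proof.
move=> mE /andP[eta0 eta1]; have := lebesgue_density mE.
apply: (@filterS _ _ (ae_filter_ringOfSetsType leb)) => x + Ex.
rewrite indicE mem_set// => dens.
move: dens => /fine_cvgP[_ /(@cvgr_gt _ _ _ _ _ _)/(_ (1 - eta / 2))].
move=> []; first by rewrite /=; lra.
move=> d /= d0 Hd; exists (d / 2); first by rewrite divr_gt0.
move=> h /andP[h0 hd]; apply: contrapT => noT.
have r0 : 0 < 2 * `|h| by lra.
have rd : ball_ Num.norm 0 d (2 * `|h|) by rewrite /= sub0r normrN gtr0_norm//; lra.
have := Hd _ rd r0; apply/negP; rewrite -leNgt.
pose I := `](x + h - eta * `|h|), (x + h + eta * `|h|)[%classic : set (measurableTypeR R).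
pose B : set (measurableTypeR R) := ball x (2 * `|h|).
have mI : measurable I by exact: measurable_itv.
have mB : measurable B by exact: measurable_ball.
have IB : I `<=` B.
  move=> z; rewrite /I /B /ball /= in_itv/= => /andP[z1 z2].
  have := ler_norm h; have := ler_norm (- h); rewrite normrN => n1 n2.
  have : eta * `|h| <= `|h| by rewrite ler_piMl.
  by rewrite ltr_norml => n3; apply/andP; split; lra.
have EI : (E `&` B) `<=` B `\` I.
  move=> z [Ez Bz]; split => // Iz; apply: noT.
  exists ((z - x - h) / (eta * h)); last first.
    have -> : x + h + eta * h * ((z - x - h) / (eta * h)) = z.
      rewrite mulrC divfK; first by lra.
      by rewrite mulf_neq0 ?(gt_eqF eta0)// -normr_gt0.
    exact: Ez.
  rewrite -ler_norml normrM normfV normrM (gtr0_norm eta0) ler_pdivrMr ?mulr_gt0// mul1r.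
  move: Iz; rewrite /I/= in_itv/= => /andP[z1 z2].
  by rewrite ler_norml; apply/andP; split; lra.
have muB : leb B = (2 * `|h| *+ 2)%:E by rewrite /B lebesgue_measure_ball// ltW.
have muI : leb I = (2 * (eta * `|h|))%:E.
  rewrite /I lebesgue_measure_itv/= lte_fin ifT; last by nra.
  by rewrite -EFinB; congr EFin; lra.
have muBI : leb (B `\` I) = (2 * `|h| *+ 2 - 2 * (eta * `|h|))%:E.
  rewrite measureD//= ?muB ?ltry// (setIidr IB).
  by rewrite [X in (_ - X)%E]muI EFinB.
have muE : (leb (E `&` B) <= (2 * `|h| *+ 2 - 2 * (eta * `|h|))%:E)%E.
  rewrite -muBI; apply: le_measure => //; rewrite inE; last exact: measurableD.
  exact: measurableI.
have finE : leb (E `&` B) \is a fin_num.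
  rewrite ge0_fin_numE//; apply: le_lt_trans muE _; exact: ltry.
rewrite -[ball _ _]/B muB inver ifF; last by rewrite gt_eqF// pmulrn_lgt0.
rewrite fineM//= ler_pdivrMr; last by rewrite pmulrn_lgt0.
move: muE; rewrite -(fineK finE) lee_fin; set m := fine _ => h1.
by apply: le_trans h1 _; rewrite -mulr_natr; nra.
Qed.
End PlaneMeasure.

(** * Derivatives through countably many slope conditions *)

Section Slopes.
Context {R : realType}.

Definition nth_rat (i : nat) : rat := odflt 0 (unpickle i).

Lemma nth_rat_surj (q : rat) : exists i, nth_rat i = q.
Proof. by exists (pickle q); rewrite /nth_rat pickleK. Qed.

(** Precision, radius and slope are all indexed by integers, so that existence of a derivative
    involves only countable unions and intersections. *)
Definition slope_within (phi : R -> R) (m j i : nat) :=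
  forall t, `|t| <= j.+1%:R^-1 -> `|phi t - ratr (nth_rat i) * t| <= `|t| / m.+1%:R.

Lemma ltr_invS (e : R) : 0 < e -> exists n : nat, n.+1%:R^-1 < e.
Proof.
move=> e0; exists (Num.bound e^-1).
rewrite invf_plt ?posrE// (lt_trans (archi_boundP _))// ?invr_ge0 ?ltW//.
by rewrite ltr_nat.
Qed.

Lemma derivable_slope (g : R -> R) (y : R) : derivable g y 1 ->
  forall m, exists j i, slope_within (fun t => g (y + t) - g y) m j i.
Proof.
move=> /cvg_ex[d hd] m; set e : R := m.+1%:R^-1.
have e0 : 0 < e by rewrite invr_gt0.
have [q /andP[q1 q2]] : exists q : rat, d - e / 2 < ratr q < d + e / 2.
  have /rat_in_itvoo[q] : d - e / 2 < d + e / 2 by lra.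
  by rewrite in_itv; exists q.
have [i iq] := nth_rat_surj q.
have e20 : 0 < e / 2 by lra.
have [r /= r0 hr] := (@cvgrPdist_le _ _ _ _ _ _ _).1 hd _ e20.
have [j jr] := ltr_invS r0.
exists j, i => t tj; have [->|t0] := eqVneq t 0.
  by rewrite addr0 subrr mulr0 subr0 !normr0 mul0r.
have := hr t; rewrite /= sub0r normrN => /(_ (le_lt_trans tj jr) t0).
rewrite iq /GRing.scale/= mulr1 [t + y]addrC.
set D := g (y + t) - g y => h.
have -> : D - ratr q * t = (t^-1 * D - ratr q) * t.
  by rewrite -[D in LHS]mul1r -(mulVf t0); lra.
rewrite normrM mulrC ler_wpM2l//.
move: h; rewrite !ler_norml => /andP[h1 h2]; rewrite -/e; apply/andP; split; lra.
Qed.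

(** Two approximate slopes compared at a common [t] differ by at most the sum of their precisions;
    the supremum of the lower bounds is therefore within each precision of the corresponding
    slope. *)
Lemma slope_exists (phi : R -> R) :
  (forall m, exists j i, slope_within phi m j i) ->
  exists a, forall e, 0 < e -> exists2 d, 0 < d &
    forall t, `|t| < d -> `|phi t - a * t| <= e * `|t|.
Proof.
move=> H; pose A := [set s : R | exists m j i, slope_within phi m j i /\
  s = ratr (nth_rat i) - m.+1%:R^-1].
have ub m j i : slope_within phi m j i -> ubound A (ratr (nth_rat i) + m.+1%:R^-1).
  move=> h _ [m' [j' [i' [h' ->]]]].
  pose t : R := Num.min j.+1%:R^-1 j'.+1%:R^-1.
  have t0 : 0 < t by rewrite lt_min !invr_gt0 !ltr0n.
  have /h : `|t| <= j.+1%:R^-1 by rewrite gtr0_norm// ge_min lexx.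
  have /h' : `|t| <= j'.+1%:R^-1 by rewrite gtr0_norm// ge_min lexx orbT.
  rewrite (gtr0_norm t0) !ler_norml.
  set c := ratr _; set c' := ratr _; set u := _^-1; set u' := _^-1.
  move=> /andP[h1 h2] /andP[h3 h4].
  rewrite -subr_ge0 -(pmulr_rge0 _ t0); lra.
have [j0 [i0 h0]] := H 0%N.
have supA : has_sup A.
  split; first by exists (ratr (nth_rat i0) - 1%:R^-1), 0%N, j0, i0.
  by exists (ratr (nth_rat i0) + 1%:R^-1); exact: (ub _ _ _ h0).
exists (sup A) => e e0.
have e20 : 0 < e / 2 by lra.
have [m me] := ltr_invS e20; have [j [i h]] := H m.
exists j.+1%:R^-1; first by rewrite invr_gt0.
move=> t /ltW /h.
have s1 : sup A <= ratr (nth_rat i) + m.+1%:R^-1.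
  by apply: ge_sup; [case: supA|exact: ub h].
have s2 : ratr (nth_rat i) - m.+1%:R^-1 <= sup A.
  by apply: ub_le_sup; [case: supA|exists m, j, i].
set c := ratr _ in s1 s2 *; set u := _^-1 in me s1 s2 *; set a := sup A in s1 s2 *.
move=> ht.
have -> : phi t - a * t = (phi t - c * t) + (c - a) * t by lra.
rewrite (le_trans (ler_normD _ _))// normrM.
have : `|c - a| <= u by rewrite ler_norml; apply/andP; split; lra.
have := normr_ge0 t; nra.
Qed.
End Slopes.

(** * Differentiability almost everywhere in the plane *)

Section Rademacher.
Context {R : realType}.
Local Notation leb := (@lebesgue_measure R).

Definition monotone_nonexpansive (f : R * R -> R) :=
  (forall x x' y, x <= x' -> f (x, y) <= f (x', y) <= f (x, y) + (x' - x)) /\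
  (forall x y y', y <= y' -> f (x, y) <= f (x, y') <= f (x, y) + (y' - y)).

Variable f : R * R -> R.
Hypothesis fmono : monotone_nonexpansive f.

Lemma monotone_nonexpansive_dist p q : `|f p - f q| <= `|p.1 - q.1| + `|p.2 - q.2|.
Proof.
have [hX hY] := fmono; case: p q => [x y] [x' y'] /=.
have -> : f (x, y) - f (x', y') = (f (x, y) - f (x', y)) + (f (x', y) - f (x', y')).
  by lra.
rewrite (le_trans (ler_normD _ _))// lerD//.
  have [/[dup] h|/ltW/[dup] h] := leP x x'.
    by move/(hX _ _ y) => /andP[? ?]; rewrite !ler0_norm ?subr_le0//; lra.
  by move/(hX _ _ y) => /andP[? ?]; rewrite !ger0_norm ?subr_ge0//; lra.
have [/[dup] h|/ltW/[dup] h] := leP y y'.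
  by move/(hY x') => /andP[? ?]; rewrite !ler0_norm ?subr_le0//; lra.
by move/(hY x') => /andP[? ?]; rewrite !ger0_norm ?subr_ge0//; lra.
Qed.

Lemma monotone_nonexpansive_continuous : continuous f.
Proof.
move=> p; apply/cvgrPdist_le => e e0; near=> q.
rewrite (le_trans (monotone_nonexpansive_dist _ _))//.
have h1 : `|p.1 - q.1| <= e / 2.
  near: q; apply: (@cvgr_dist_le _ _ _ _ _ (fun q : R * R => q.1) p.1).
    exact: cvg_fst.
  by rewrite divr_gt0.
have h2 : `|p.2 - q.2| <= e / 2.
  near: q; apply: (@cvgr_dist_le _ _ _ _ _ (fun q : R * R => q.2) p.2).
    exact: cvg_snd.
  by rewrite divr_gt0.
lra.
Unshelve. all: by end_near. Qed.

Definition slope_set (v : R * R) (m j i : nat) : set (R * R) :=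
  [set p | slope_within (fun t => f (p + t *: v) - f p) m j i].

Lemma closed_slope_set v m j i : closed (slope_set v m j i).
Proof.
have -> : slope_set v m j i = \bigcap_(t in [set t : R | `|t| <= j.+1%:R^-1])
   [set p | `|f (p + t *: v) - f p - ratr (nth_rat i) * t| <= `|t| / m.+1%:R].
  by apply/seteqP; split => p /=.
apply: closed_bigI => t _.
pose G (p : R * R) : R := `|f (p + t *: v) - f p - ratr (nth_rat i) * t|.
rewrite -[X in closed X]/(G @^-1` [set y | y <= `|t| / m.+1%:R]).
apply: preimage_closed; last exact: closed_le.
move=> p _; apply: cvg_norm; apply: cvgB; last exact: cvg_cst.
apply: cvgB; last exact: monotone_nonexpansive_continuous.
have c : (fun p : R * R => p + t *: v) @ p --> p + t *: v.
  by apply: cvgD; [exact: cvg_id|exact: cvg_cst].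
have := cvg_comp _ f c; apply; exact: monotone_nonexpansive_continuous.
Qed.

(* Countable unions and intersections of closed sets describe non-derivability
   along [v], hence Fubini applies to it. *)
Definition no_slope (v : R * R) : set (plane R) :=
  [set p | exists m, forall j i, ~ slope_set v m j i p].

Lemma measurable_no_slope v : measurable (no_slope v).
Proof.
have -> : no_slope v = \bigcup_m \bigcap_j \bigcap_i ~` slope_set v m j i.
  apply/seteqP; split=> p.
    by move=> [m h]; exists m => // j _ i _; exact: h.
  by move=> [m _ h]; exists m => j i; exact: h.
apply: bigcupT_measurable => m; apply: bigcapT_measurable => j.
apply: bigcapT_measurable => i; apply: measurableC.
by apply: closed_measurable_plane; exact: closed_slope_set.
Qed.

Lemma null_not_derivable (g : R -> R) (N : set (measurableTypeR R)) :
  (forall x y, x <= y -> g x <= g y <= g x + (y - x)) -> measurable N ->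
  N `<=` [set x | ~ derivable g x 1] -> leb N = 0%E.
Proof.
move=> hg mN sN; apply/negligibleP => //.
by apply: negligibleS sN _; exact: ae_derivable_nondecreasing_nonexpansive.
Qed.

(** On each vertical line the one-variable result makes the bad points negligible; Fubini
    concludes. *)
Lemma null_no_slope_y : (leb \x leb)%E (no_slope (0, 1)) = 0%E.
Proof.
apply: product_null_xsection; first exact: measurable_no_slope.
move=> x; apply: (@null_not_derivable (fun y => f (x, y))).
- by move=> y y'; exact: fmono.2.
- by apply: measurable_xsection; exact: measurable_no_slope.
- move=> y; rewrite /xsection/= inE => -[m Hm] /derivable_slope/(_ m)[j [i h]].
  apply: (Hm j i) => t /h; rewrite /= {1}/GRing.scale/=.
  by have -> : (x, y) + t *: ((0, 1) : R * R) = (x, y + t)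
    by congr (_, _); rewrite /= /GRing.scale/= ?mulr0 ?mulr1 ?addr0.
Qed.

Lemma null_no_slope_x : (leb \x leb)%E (no_slope (1, 0)) = 0%E.
Proof.
apply: product_null_ysection; first exact: measurable_no_slope.
move=> y; apply: (@null_not_derivable (fun x => f (x, y))).
- by move=> x x'; exact: fmono.1.
- by apply: measurable_ysection; exact: measurable_no_slope.
- move=> x; rewrite /ysection/= inE => -[m Hm] /derivable_slope/(_ m)[j [i h]].
  apply: (Hm j i) => t /h; rewrite /= {1}/GRing.scale/=.
  by have -> : (x, y) + t *: ((1, 0) : R * R) = (x + t, y)
    by congr (_, _); rewrite /= /GRing.scale/= ?mulr0 ?mulr1 ?addr0.
Qed.

(* The points of [E] whose horizontal line misses [E] on intervals of relative
   length [2 / n.+1] arbitrarily close to them; none is a density point. *)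
Definition porous_part (E : set (R * R)) (n : nat) : set (plane R) :=
  E `&` \bigcap_l \bigcup_(h in [set h : R | 0 < `|h| < l.+1%:R^-1])
    [set p | forall t, -1 <= t <= 1 -> ~ E (p.1 + h + n.+1%:R^-1 * h * t, p.2)].

Lemma measurable_porous_part E n : closed E -> measurable (porous_part E n).
Proof.
move=> cE; apply: measurableI; first exact: closed_measurable_plane.
apply: bigcapT_measurable => l; apply: open_measurable_plane.
apply: bigcup_open => h _.
apply: (@tube_open _ _ (fun p t => (p.1 + h + n.+1%:R^-1 * h * t, p.2))) => // z.
have c1 : (w.1.1 @[w --> z] --> z.1.1) by apply: (cvg_comp fst fst); exact: cvg_fst.
have c2 : (w.1.2 @[w --> z] --> z.1.2).
  by apply: (cvg_comp fst snd); [exact: cvg_fst|exact: cvg_snd].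
have c3 : ((w.1.1 + h + n.+1%:R^-1 * h * w.2) @[w --> z] -->
    z.1.1 + h + n.+1%:R^-1 * h * z.2).
  apply: cvgD; first by apply: cvgD; [exact: c1|exact: cvg_cst].
  by apply: cvgM; [exact: cvg_cst|exact: cvg_snd].
exact: cvg_pair c3 c2.
Qed.

Lemma null_porous_part E n : closed E -> (leb \x leb)%E (porous_part E n) = 0%E.
Proof.
move=> cE; apply: product_null_ysection; first exact: measurable_porous_part.
move=> y; pose Ey := ysection (E : set (plane R)) y.
have mEy : measurable Ey.
  by apply: measurable_ysection; exact: closed_measurable_plane.
have n01 : 0 < (n.+1%:R^-1 : R) <= 1.
  by rewrite invr_gt0 ltr0n/= invf_le1 ?ltr0n// ler1n.
apply/negligibleP.
  by apply: measurable_ysection; exact: measurable_porous_part.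
apply: negligibleS (ae_not_porous mEy n01) => x.
rewrite /ysection/= inE => -[Exy H] h.
have Eyx : Ey x by rewrite /Ey /ysection/= inE.
have [d d0 hd] := h Eyx.
have [l ld] := ltr_invS d0.
have [k /= /andP[k0 kl] Hk] := H l I.
have [|t tt] := hd k; first by rewrite k0 (lt_trans kl).
by rewrite /Ey /ysection/= inE; exact: Hk.
Qed.

Lemma not_no_slope v p : ~ no_slope v p ->
  forall m, exists j i, slope_set v m j i p.
Proof.
move=> h m; apply: contrapT => h'; apply: h; exists m => j i hp; apply: h'.
by exists j, i.
Qed.

(* To estimate [f (p + (h, k)) - f p], move horizontally to a nearby point of the
   slope set given by non-porosity, where the vertical slope is uniformly close
   to the one at [p]. *)
Lemma differentiable_of_slopes (p : R * R) :
  ~ no_slope (1, 0) p -> ~ no_slope (0, 1) p ->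
  (forall m j i n, ~ porous_part (slope_set (0, 1) m j i) n p) ->
  differentiable f p.
Proof.
move=> /not_no_slope hx /not_no_slope hy hbad.
have [a ha] := slope_exists hx; have [b hb] := slope_exists hy.
apply: (@differentiable_linear_form _ _ _ a b) => e e0.
(* The five errors estimated below add up to at most [3 * e'] times each coordinate of the
   increment. *)
pose e' := e / 4; have e'0 : 0 < e' by rewrite /e'; lra.
have [n nE] := ltr_invS e'0.
have [j [i hji]] := hy n.
have [l Hl] : exists l, forall h, 0 < `|h| < l.+1%:R^-1 ->
    exists2 t, -1 <= t <= 1 &
      slope_set (0, 1) n j i (p.1 + h + n.+1%:R^-1 * h * t, p.2).
  apply: contrapT => H; apply: (hbad n j i n); split => // l _.
  apply: contrapT => H'; apply: H; exists l => h hl.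
  apply: contrapT => H; apply: H'; exists h => //= t tt Et.
  by apply: H; exists t.
have [d1 d10 hd1] := ha _ e'0; have [d2 d20 hd2] := hb _ e'0.
set eta : R := n.+1%:R^-1 in nE Hl.
have eta0 : 0 < eta by rewrite /eta invr_gt0.
pose c : R := ratr (nth_rat i).
(* At [p] both [c] and [b] approximate the same vertical increments, with errors [eta < e'] and
   [e']. *)
have cb : `|c - b| <= 2 * e'.
  pose t := Num.min (d2 / 2) j.+1%:R^-1.
  have t0 : 0 < t by rewrite lt_min invr_gt0 ltr0n divr_gt0.
  have td : `|t| < d2 by rewrite gtr0_norm// gt_min; apply/orP; left; lra.
  have tj : `|t| <= j.+1%:R^-1 by rewrite gtr0_norm// ge_min lexx orbT.
  have := hd2 _ td; have := hji _ tj; rewrite (gtr0_norm t0) -/c -/eta.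
  set D := f _ - f _; rewrite !ler_norml => /andP[h1 h2] /andP[h3 h4].
  by apply/andP; split; rewrite -subr_ge0 -(pmulr_rge0 _ t0); nra.
pose r := Num.min (Num.min d1 d2) (Num.min j.+1%:R^-1 l.+1%:R^-1).
have r0 : 0 < r by rewrite !lt_min d10 d20 !invr_gt0 !ltr0n.
near=> hk.
have : `|hk| < r by near: hk; exact: (@nbhs0_lt R (R * R)%type).
have -> : `|hk| = Num.max `|hk.1| `|hk.2| by [].
rewrite gt_max => /andP[hr kr].
case: (hk) hr kr => [h k] /= hr kr; move: hr kr; rewrite /r !lt_min.
move=> /andP[/andP[h1 _] /andP[_ h2]] /andP[/andP[_ k1] /andP[/ltW k2 _]].
have X : `|f (p.1 + h, p.2) - f p - a * h| <= e' * `|h|.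
  have := hd1 _ h1; rewrite [p in f (p + _)]surjective_pairing.
  by have -> : (p.1, p.2) + h *: ((1, 0) : R * R) = (p.1 + h, p.2)
    by congr (_, _); rewrite /= /GRing.scale/= ?mulr0 ?mulr1 ?addr0.
have vE x y : (x, y) + k *: ((0, 1) : R * R) = (x, y + k).
  by congr (_, _); rewrite /= /GRing.scale/= ?mulr0 ?mulr1 ?addr0.
rewrite /linear_form/=; have -> : p + (h, k) = (p.1 + h, p.2 + k) by [].
(* Non-porosity says nothing for [h = 0], where the vertical slope at [p] is enough. *)
have [h0|h0] := eqVneq h 0.
  have := hd2 _ k1; rewrite [p in f (p + _)]surjective_pairing vE.
  rewrite h0 addr0 normr0 mulr0 add0r => /le_trans; apply.
  by rewrite add0r ler_wpM2r// /e'; lra.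
have [|t tt] := Hl h; first by rewrite normr_gt0 h0.
set x := p.1 + h + _; move=> /(_ k k2); rewrite vE -/c -/eta => Y.
have hx1 : `|p.1 + h - x| <= e' * `|h|.
  rewrite /x opprD addrA subrr add0r normrN !normrM (gtr0_norm eta0).
  have : `|t| <= 1 by rewrite ler_norml.
  move=> t1; rewrite mulrAC ler_wpM2r// -[leRHS]mulr1 ler_pM// ?(ltW eta0)//.
  exact: ltW.
have Z1 := monotone_nonexpansive_dist (p.1 + h, p.2 + k) (x, p.2 + k).
have Z2 := monotone_nonexpansive_dist (x, p.2) (p.1 + h, p.2).
move: Z1 Z2; rewrite /= !subrr normr0 !addr0 [`|x - _|]distrC => Z1 Z2.
(* Path: sideways to the abscissa [x] at height [p.2 + k], down to height [p.2], back sideways, then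
   to [p]; the last term replaces [c] by [b]. *)
rewrite [X in `|X|](_ : _ =
  (f (p.1 + h, p.2 + k) - f (x, p.2 + k)) + (f (x, p.2 + k) - f (x, p.2) - c * k)
  + (f (x, p.2) - f (p.1 + h, p.2)) + (f (p.1 + h, p.2) - f p - a * h) + (c - b) * k);
  last by lra.
have T5 : `|(c - b) * k| <= 2 * e' * `|k| by rewrite normrM ler_wpM2r.
have T2 : `|f (x, p.2 + k) - f (x, p.2) - c * k| <= e' * `|k|.
  by rewrite (le_trans Y)// mulrC ler_wpM2r// ltW.
have T1 := le_trans Z1 hx1; have T3 := le_trans Z2 hx1.
move: T1 T2 T3 X T5.
set t1 := _ - _; set t2 := _ - _ - _; set t3 := _ - _; set t4 := _ - _ - _; set t5 := (c - b) * k.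
clearbody t1 t2 t3 t4 t5; clear -e0.
rewrite /e' !ler_norml => /andP[? ?] /andP[? ?] /andP[? ?] /andP[? ?] /andP[? ?].
have := mulr_ge0 (ltW e0) (normr_ge0 h); have := mulr_ge0 (ltW e0) (normr_ge0 k).
by move=> ? ?; apply/andP; split; lra.
Unshelve. all: by end_near. Qed.

(** Rademacher's theorem for [f]: the exceptional points lie in countably many null sets, as all
    indices are integers. *)
Lemma ae_differentiable_monotone_nonexpansive :
  {ae (leb \x leb)%E, forall p : R * R, differentiable f p}.
Proof.
have ae0 (N : set (plane R)) : measurable N -> (leb \x leb)%E N = 0%E ->
    {ae (leb \x leb)%E, forall p, ~ N p}.
  move=> mN N0; exists N; split => // p /=; exact: contrapT.
have H1 := ae0 _ (measurable_no_slope (1, 0)) null_no_slope_x.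
have H2 := ae0 _ (measurable_no_slope (0, 1)) null_no_slope_y.
have H3 : {ae (leb \x leb)%E, forall p, forall m j i n,
    ~ porous_part (slope_set (0, 1) m j i) n p}.
  do 4!apply: ae_foralln => ?.
  apply: ae0; [apply: measurable_porous_part|apply: null_porous_part];
    exact: closed_slope_set.
apply: (@filterS3 _ _ (ae_filter_ringOfSetsType (leb \x leb)%E) _ _ _ _ _ H1 H2 H3).
by move=> p; exact: differentiable_of_slopes.
Qed.
End Rademacher.

(** * The functions V_k *)

Section Closure.
Context {R : realType}.

(** Being strictly oppositely ordered is an open condition on pairs, so a bad pair in the closure
    yields one in [B]. *)
Lemma closure_nondecreasing (B : set (R * R)) :
  nondecreasing_set B -> nondecreasing_set (closure B).
Proof.
move=> ndB p q clp clq; rewrite leNgt; apply/negP => pq.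
(* Moving both points by less than [d / 2] in each coordinate keeps the signs of both
   differences. *)
pose d := Num.min `|q.1 - p.1| `|q.2 - p.2|.
have [n1 n2] : q.1 - p.1 != 0 /\ q.2 - p.2 != 0.
  by split; apply/eqP => h; move: pq; rewrite h ?mul0r ?mulr0 ltxx.
have d0 : 0 < d / 2 by rewrite divr_gt0// lt_min !normr_gt0 n1.
have d1 : d <= `|q.1 - p.1| by rewrite ge_min lexx.
have d2 : d <= `|q.2 - p.2| by rewrite ge_min lexx orbT.
have [p' [Bp' [/= p1 p2]]] := clp _ (nbhsx_ballx p _ d0).
have [q' [Bq' [/= q1 q2]]] := clq _ (nbhsx_ballx q _ d0).
have := ndB _ _ Bp' Bq'.
move: p1 p2 q1 q2 d1 d2; rewrite /ball/= !ltr_norml.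
move=> /andP[? ?] /andP[? ?] /andP[? ?] /andP[? ?].
case: (ltgtP (q.1 - p.1) 0) n1 => // s1 _; case: (ltgtP (q.2 - p.2) 0) n2 => // s2 _.
- by move: pq; rewrite nmulr_rlt0// ltNge ltW.
- rewrite (ltr0_norm s1) (gtr0_norm s2) => ? ?.
  by rewrite nmulr_rge0; lra.
- rewrite (gtr0_norm s1) (ltr0_norm s2) => ? ?.
  by rewrite pmulr_rge0; lra.
- by move: pq; rewrite pmulr_rlt0// ltNge ltW.
Qed.

Lemma closed_bigcup_closure (k : nat) (E : 'I_k -> set (R * R)) :
  closed (\bigcup_i closure (E i)).
Proof. apply: closed_bigcup => [|i _]; [exact: finite_finset|exact: closed_closure]. Qed.

Lemma k_nondecreasing_drop (k : nat) (i0 : 'I_k.+1) (E : 'I_k.+1 -> set (R * R)) :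
  (forall i, nondecreasing_set (E i)) -> E i0 = set0 ->
  k_nondecreasing_set k (\bigcup_i E i).
Proof.
move=> ndE E0; exists (fun j => E (lift i0 j)); split => [j|]; first exact: ndE.
apply/seteqP; split => p [i _ Ei]; last by exists (lift i0 i).
case: (unliftP i0 i) => [j ij|ii]; first by exists j => //; rewrite -ij.
by move: Ei; rewrite ii E0.
Qed.
End Closure.

Section LISValues.
Context {R : realType} (mu : probability (plane R) R).
Hypothesis hmu : is_permuton mu.

Definition mass (A : set (plane R)) : R := fine (mu A).

Lemma mass_le (A B : set (plane R)) : measurable A -> measurable B ->
  A `<=` B -> mass A <= mass B.
Proof.
move=> mA mB AB; rewrite /mass fine_le ?fin_num_measure//.
by rewrite le_measure ?inE.
Qed.

Lemma mass0 : mass set0 = 0.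
Proof. by rewrite /mass measure0. Qed.

Lemma mass_ge0 A : 0 <= mass A.
Proof. by rewrite /mass fine_ge0. Qed.

Lemma massUI (A B : set (plane R)) : measurable A -> measurable B ->
  mass A + mass B = mass (A `|` B) + mass (A `&` B).
Proof.
move=> mA mB.
rewrite /mass measureUfinr ?ltey_eq ?fin_num_measure// fineB ?fin_numD ?fin_num_measure//.
  by rewrite fineD ?fin_num_measure// subrK.
exact: measurableI.
Qed.

Lemma mass_setU_le (A B C : set (plane R)) : measurable A -> measurable B ->
  measurable C -> A `<=` B `|` C -> mass A <= mass B + mass C.
Proof.
move=> mA mB mC ABC; rewrite massUI//.
rewrite (le_trans (mass_le mA _ ABC)) ?lerDl ?mass_ge0//.
exact: measurableU.
Qed.

Lemma uniform_prob_itv_le (a b : R) : a <= b ->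
  (uniform_prob (@ltr01 R) `]a, b]%classic <= (b - a)%:E)%E.
Proof.
move=> ab; rewrite /uniform_prob.
apply: (@le_trans _ _ (\int[lebesgue_measure]_(x in `]a, b]%classic) cst 1 x)%E).
  apply: ge0_le_integral => //.
  - by move=> x _; rewrite lee_fin uniform_pdf_ge0.
  - by apply/measurable_EFinP; apply: measurable_funTS; exact: measurable_uniform_pdf.
  - by move=> x _; rewrite lee_fin /uniform_pdf subr0 invr1; case: (0 <= x <= 1).
rewrite integral_cst//= mul1e lebesgue_measure_itv/= lte_fin.
by case: ltP => // _; rewrite lee_fin subr_ge0.
Qed.

Definition vstrip (a b : R) : set (plane R) := [set p | a < p.1 <= b].
Definition hstrip (a b : R) : set (plane R) := [set p | a < p.2 <= b].

Lemma vstripE a b : vstrip a b = fst @^-1` `]a, b]%classic.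
Proof. by apply/seteqP; split => p; rewrite /vstrip/= in_itv. Qed.

Lemma hstripE a b : hstrip a b = snd @^-1` `]a, b]%classic.
Proof. by apply/seteqP; split => p; rewrite /hstrip/= in_itv. Qed.

Lemma measurable_vstrip a b : measurable (vstrip a b).
Proof.
by rewrite vstripE -[X in measurable X]setTI; apply: measurable_fst => //; exact: measurable_itv.
Qed.

Lemma measurable_hstrip a b : measurable (hstrip a b).
Proof.
by rewrite hstripE -[X in measurable X]setTI; apply: measurable_snd => //; exact: measurable_itv.
Qed.

Lemma mass_vstrip_le (a b : R) : a <= b -> mass (vstrip a b) <= b - a.
Proof.
move=> ab; rewrite -lee_fin fineK ?fin_num_measure//; last exact: measurable_vstrip.
have [_ h _] := hmu; rewrite vstripE [X in (X <= _)%E]h; last exact: measurable_itv.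
exact: uniform_prob_itv_le.
Qed.

Lemma mass_hstrip_le (a b : R) : a <= b -> mass (hstrip a b) <= b - a.
Proof.
move=> ab; rewrite -lee_fin fineK ?fin_num_measure//; last exact: measurable_hstrip.
have [_ _ h] := hmu; rewrite hstripE [X in (X <= _)%E]h; last exact: measurable_itv.
exact: uniform_prob_itv_le.
Qed.

Definition lisval (k : nat) (p : R * R) : R :=
  fine (LIS k (mrestr mu (measurable_box p.1 p.2))).

(** Requiring [A] to lie in the box lets [mu] itself replace its restriction; intersecting with the
    box shows that the supremum is unchanged. *)
Definition admissible (k : nat) (p : R * R) (A : set (R * R)) :=
  [/\ A `<=` unit_square, A `<=` box p.1 p.2, closed A & k_nondecreasing_set k A].

Lemma closed_box (x y : R) : closed (box x y : set (R * R)).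
Proof.
have -> : (box x y : set (R * R)) = fst @^-1` `[0, x]%classic `&` snd @^-1` `[0, y]%classic.
  by apply/seteqP; split => p /=.
apply: closedI; apply: preimage_closed; try exact: interval_closed.
  by move=> p _; exact: cvg_fst.
by move=> p _; exact: cvg_snd.
Qed.

Lemma k_nondecreasing_setI k (A C : set (R * R)) :
  k_nondecreasing_set k A -> k_nondecreasing_set k (A `&` C).
Proof.
move=> [B [ndB ->]]; exists (fun i => B i `&` C); split; last by rewrite setI_bigcupl.
by move=> i p q [Bp _] [Bq _]; exact: ndB Bp Bq.
Qed.

Lemma k_nondecreasing_set0 k : k_nondecreasing_set k (set0 : set (R * R)).
Proof.
by exists (fun _ => set0); split => [i p q //|]; rewrite bigcup0.
Qed.

Lemma LIS_fin k p : LIS k (mrestr mu (measurable_box p.1 p.2)) \is a fin_num.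
Proof.
case: k => [|k] //=; rewrite fin_numElt; apply/andP; split.
  apply: (@lt_le_trans _ _ 0%E); first exact: ltNyr.
  apply: ereal_sup_ubound; exists set0; last by rewrite measure0.
  by split; [move=> q|exact: closed0|exact: k_nondecreasing_set0].
apply: (@le_lt_trans _ _ 1%E); last exact: ltry.
apply: ge_ereal_sup => _ [A [_ cA _] <-]; rewrite /mrestr/= probability_le1//.
by apply: measurableI; [exact: closed_measurable_plane|exact: measurable_box].
Qed.

Lemma mass_le_lisval k p A : admissible k p A -> mass A <= lisval k p.
Proof.
move=> [AU Ab cA kA]; rewrite /mass /lisval; case: k kA => [|k] kA.
  have -> : A = set0.
    by case: kA => B [_ ->]; apply/seteqP; split => // q [[]].
  by rewrite measure0.
rewrite fine_le ?LIS_fin ?fin_num_measure//; first exact: closed_measurable_plane.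
apply: ereal_sup_ubound; exists A => //.
by congr (mu _); exact: setIidl.
Qed.

Lemma lisval_adherent k p (e : R) : 0 < e ->
  exists2 A, admissible k p A & lisval k p < mass A + e.
Proof.
move=> e0; case: k => [|k].
  exists set0; last by rewrite /lisval /mass /= measure0 add0r.
  by split; [move=> q|move=> q|exact: closed0|exact: k_nondecreasing_set0].
have /(ub_ereal_sup_adherent e0) := LIS_fin k.+1 p.
move=> [_ [A [AU cA kA] <-]] h; exists (A `&` box p.1 p.2).
  split; [by move=> q [/AU]|by move=> q []|by apply: closedI => //; exact: closed_box|].
  exact: k_nondecreasing_setI.
rewrite -lte_fin EFinD /lisval /mass fineK; last exact: LIS_fin.
rewrite fineK; last first.
  apply: fin_num_measure; apply: measurableI; last exact: measurable_box.
  exact: closed_measurable_plane.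
by rewrite -lteBlDr.
Qed.
End LISValues.

(** * Lipschitz bounds and exchange of masses *)

Section LISExchange.
Context {R : realType} (mu : probability (plane R) R).
Hypothesis hmu : is_permuton mu.
Local Notation mass := (mass mu).
Local Notation lisval := (lisval mu).

Lemma box_subset (x x' y y' : R) : x <= x' -> y <= y' -> box x y `<=` box x' y'.
Proof.
move=> xx yy p [/=]; rewrite !in_itv/= => /andP[p1 p2] /andP[p3 p4].
by split; rewrite /= in_itv/= ?p1 ?p3 (le_trans _ xx, le_trans _ yy).
Qed.

Lemma box_setU_vstrip (x x' y : R) : x <= x' ->
  box x' y `<=` box x y `|` vstrip x x'.
Proof.
move=> xx p [/=]; rewrite !in_itv/= => /andP[p1 p2] p3.
have [px|px] := leP p.1 x; last by right; rewrite /vstrip/= px.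
by left; split; rewrite /= in_itv//= p1.
Qed.

Lemma box_setU_hstrip (x y y' : R) : y <= y' ->
  box x y' `<=` box x y `|` hstrip y y'.
Proof.
move=> yy p [/=]; rewrite !in_itv/= => p3 /andP[p1 p2].
have [px|px] := leP p.2 y; last by right; rewrite /hstrip/= px.
by left; split; rewrite /= in_itv//= p1.
Qed.

Definition massbox (p : R * R) : R := mass (box p.1 p.2).

(** Enlarging the box adds points of a single strip, whose mass is at most its width because the
    marginals are uniform. *)
Lemma massbox_monotone_nonexpansive : monotone_nonexpansive massbox.
Proof.
split=> [x x' y xx|x y y' yy]; rewrite /massbox/=; apply/andP; split.
- by apply: mass_le; try exact: measurable_box; exact: box_subset.
- have := @mass_setU_le _ mu _ _ _ (measurable_box x' y) (measurable_box x y)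
    (measurable_vstrip x x') (box_setU_vstrip xx).
  by have := mass_vstrip_le hmu xx; lra.
- by apply: mass_le; try exact: measurable_box; exact: box_subset.
- have := @mass_setU_le _ mu _ _ _ (measurable_box x y') (measurable_box x y)
    (measurable_hstrip y y') (box_setU_hstrip yy).
  by have := mass_hstrip_le hmu yy; lra.
Qed.

Lemma admissible_mass_le k (x y : R) (S : set (plane R)) (A : set (R * R)) d :
  A `<=` unit_square -> closed A -> k_nondecreasing_set k A ->
  measurable S -> A `<=` box x y `|` S -> mass S <= d -> mass A <= lisval k (x, y) + d.
Proof.
move=> AU cA kA mS AS Sd.
apply: (le_trans (@mass_setU_le _ mu A (A `&` box x y) S _ _ mS _)).
- exact: closed_measurable_plane.
- by apply: measurableI; [exact: closed_measurable_plane|exact: measurable_box].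
- by move=> p Ap; have [?|?] := AS p Ap; [left|right].
apply: lerD => //; apply: mass_le_lisval; split => /=.
- by move=> p [/AU].
- by move=> p [].
- by apply: closedI => //; exact: closed_box.
- exact: k_nondecreasing_setI.
Qed.

(** A near-optimal set for the first box, cut down to the second, loses at most the mass of [S]. *)
Lemma lisval_le k (x y x' y' : R) (S : set (plane R)) d :
  measurable S -> box x' y' `<=` box x y `|` S -> mass S <= d ->
  lisval k (x', y') <= lisval k (x, y) + d.
Proof.
move=> mS bS Sd; apply/ler_addgt0Pr => e e0.
have [A [AU Ab cA kA] /ltW h] := lisval_adherent mu k (x', y') e0.
apply: (le_trans h); rewrite lerD2r.
by apply: admissible_mass_le kA mS _ Sd => //; exact: subset_trans Ab bS.
Qed.

Lemma lisval_monotone_nonexpansive k : monotone_nonexpansive (lisval k).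
Proof.
have sub (x y x' y' : R) : x <= x' -> y <= y' -> lisval k (x, y) <= lisval k (x', y').
  move=> xx yy; rewrite -[leRHS]addr0; apply: (@lisval_le _ _ _ _ _ set0) => //.
    by rewrite setU0; exact: box_subset.
  by rewrite mass0.
split=> [x x' y xx|x y y' yy]; apply/andP; split; try exact: sub.
  apply: (@lisval_le _ _ _ _ _ (vstrip x x')).
  - exact: measurable_vstrip.
  - exact: box_setU_vstrip.
  - exact: mass_vstrip_le.
apply: (@lisval_le _ _ _ _ _ (hstrip y y')).
- exact: measurable_hstrip.
- exact: box_setU_hstrip.
- exact: mass_hstrip_le.
Qed.

(* [lose c] is [1] when family [c] has an empty slot, so that it needs only [k]
   chains. *)
Lemma exchange_mass k (A B : 'I_k.+1 -> set (R * R)) (x y x' y' : R)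
    (eps : 'I_k.+1 -> bool) :
    (forall i, nondecreasing_set (A i)) -> (forall i, nondecreasing_set (B i)) ->
    measurable (\bigcup_i A i : set (plane R)) ->
    measurable (\bigcup_i B i : set (plane R)) ->
    x <= x' -> y <= y' ->
    \bigcup_i A i `<=` unit_square `&` box x' y' ->
    \bigcup_i B i `<=` unit_square `&` box x y ->
    (forall i p, A i p -> p.1 <= x \/ p.2 <= y) ->
    (forall i p, A i p -> x < p.1 -> eps i) ->
    (forall i p, A i p -> y < p.2 -> ~~ eps i) ->
  exists (sg : {perm 'I_k.+1}) (lose : bool -> nat),
  [/\ mass (\bigcup_i A i) + mass (\bigcup_i B i) <=
        lisval (k.+1 - lose true) (x', y) + lisval (k.+1 - lose false) (x, y'),
      forall c, (lose c <= 1)%N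
    & forall c i, (if c == eps i then A i else B (sg i)) = set0 -> lose c = 1%N].
Proof.
move=> ndA ndB mA mB xx yy AU BU DA epsR epsT.
have DB i p : B i p -> p.1 <= x /\ p.2 <= y.
  move=> Bp; have [_ [/=]] := BU p (ex_intro2 _ _ i I Bp).
  by rewrite !in_itv/= => /andP[_ ->] /andP[_ ->].
have [sg [E [ndE EI EU Ebox E0]]] := planar_exchange ndA ndB DB DA epsR epsT.
(* Admissible sets must be closed. Closures keep the chains monotone, stay in the closed boxes and
   only increase the mass. *)
pose F c := \bigcup_i closure (E c i).
have cF c : closed (F c) by exact: closed_bigcup_closure.
have mF c : measurable (F c : set (plane R)) by exact: closed_measurable_plane.
have EF c : \bigcup_i E c i `<=` F c.
  by move=> p [i _ Ep]; exists i => //; exact: subset_closure.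
pose C c : set (R * R) := unit_square `&` if c then box x' y else box x y'.
have FC c : F c `<=` C c.
  have cC : closed (C c).
    by apply: closedI; first exact: closed_box; case: (c); exact: closed_box.
  move=> p [i _]; rewrite closureE; apply; split => // q /Ebox[ABq qc].
  have [qU [/= q1 q2]] : (unit_square `&` box x' y') q.
    case: ABq => [/AU//|/BU[? ?]]; split => //; exact: (box_subset xx yy).
  move: q1 q2; rewrite !in_itv/= => /andP[? ?] /andP[? ?].
  by split => //; case: (c) qc => qc; split; rewrite /= in_itv/=; apply/andP.
pose lose c : nat := `[< exists i, (if c == eps i then A i else B (sg i)) = set0 >].
exists sg, lose; split; last 2 first.
- by move=> c; rewrite /lose; case: asboolP.
- by move=> c i h; rewrite /lose asboolT//; exists i.
have kF c : k_nondecreasing_set (k.+1 - lose c) (F c).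
  have ndC i : nondecreasing_set (closure (E c i)) by apply: closure_nondecreasing.
  rewrite /lose; case: asboolP => [[i0 /E0 h]|_]; last first.
    by rewrite subn0; exists (fun i => closure (E c i)).
  rewrite subn1/=; apply: (@k_nondecreasing_drop _ _ i0) => //.
  by rewrite h closure0.
apply: (@le_trans _ _ (mass (F true) + mass (F false))).
  rewrite massUI// [leRHS]massUI// lerD//; apply: mass_le.
  - exact: measurableU.
  - exact: measurableU.
  - by apply: subset_trans EU _; exact: setUSS.
  - exact: measurableI.
  - exact: measurableI.
  - by apply: subset_trans EI _; exact: setISS.
apply: lerD; apply: mass_le_lisval; split => //=.
- by move=> p /FC[].
- by move=> p /FC[].
- by move=> p /FC[].
- by move=> p /FC[].
Qed.
End LISExchange.

(** * Growth and monotonicity inequalities *)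

Section LocalRules.
Context {R : realType} (mu : probability (plane R) R).
Hypothesis hmu : is_permuton mu.
Local Notation mass := (mass mu).
Local Notation lisval := (lisval mu).
Local Notation massbox := (massbox mu).

(** An empty last chain lets a family of [k] chains be paired with one of [k.+1]; following it shows
    which new family saves a chain. *)
Lemma k_nondecreasing_pad k (A : set (R * R)) : k_nondecreasing_set k A ->
  exists B : 'I_k.+1 -> set (R * R),
  [/\ forall i, nondecreasing_set (B i), A = \bigcup_i B i & B ord_max = set0].
Proof.
move=> [Q [ndQ ->]].
exists (fun i => if unlift ord_max i is Some j then Q j else set0); split.
- by move=> i p q; case: unlift => // j; exact: ndQ.
- apply/seteqP; split => p [i _].
    by exists (lift ord_max i) => //; rewrite liftK.
  by case: unlift => // j Qp; exists j.
- by rewrite unlift_none.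
Qed.

Lemma lisval_leS k p : lisval k p <= lisval k.+1 p.
Proof.
apply/ler_addgt0Pr => e e0.
have [A [AU Ab cA kA] /ltW h] := lisval_adherent mu k p e0.
apply: (le_trans h); rewrite lerD2r; apply: mass_le_lisval; split => //.
by have [B [ndB AB _]] := k_nondecreasing_pad kA; exists B.
Qed.

Lemma lisval_leB k d p : (d <= 1)%N -> lisval (k.+1 - d) p <= lisval k.+1 p.
Proof. by case: d => [|[|//]] _; rewrite ?subn0// subn1; exact: lisval_leS. Qed.

(** Inclusion-exclusion for boxes; [0 <= x] and [0 <= y] place the corner inside [box x' y']. *)
Lemma corner_mass_le (x x' y y' : R) : 0 <= x <= x' -> 0 <= y <= y' ->
  mass (vstrip x x' `&` hstrip y y') <=
    massbox (x', y') - massbox (x', y) - massbox (x, y') + massbox (x, y).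
Proof.
move=> /andP[x0 xx] /andP[y0 yy]; set C := _ `&` _.
have mC : measurable C.
  by apply: measurableI; [exact: measurable_vstrip|exact: measurable_hstrip].
have mb a b := @measurable_box R a b.
have mU : measurable (box x' y `|` box x y') by exact: measurableU.
have e1 := massUI mu (mb x' y) (mb x y').
have e2 := massUI mu mU mC.
have e3 : mass (box x' y `&` box x y') = mass (box x y).
  congr mass; apply/seteqP; split => p /=; rewrite /box/= !in_itv/=.
    by move=> [[/andP[-> _] /andP[-> ->]] [/andP[_ ->] _]].
  move=> [/andP[p1 p2] /andP[p3 p4]].
  by rewrite p1 p2 p3 p4 (le_trans p2 xx) (le_trans p4 yy).
have e4 : mass (box x' y `|` box x y' `|` C) <= mass (box x' y').
  apply: mass_le; [exact: measurableU|exact: mb|].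
  move=> p [[]|]; [exact: box_subset|exact: box_subset|].
  move=> [/= /andP[p1 p2] /andP[p3 p4]]; split; rewrite /= in_itv/= ?p2 ?p4.
    by rewrite (le_trans x0 (ltW p1)).
  by rewrite (le_trans y0 (ltW p3)).
have e5 : mass ((box x' y `|` box x y') `&` C) = 0.
  rewrite (_ : _ `&` C = set0) ?mass0//.
  apply/seteqP; split => // p [pb [/= /andP[p1 _] /andP[p2 _]]].
  case: pb => -[/=]; rewrite !in_itv/= => /andP[_ h1] /andP[_ h2].
    by move: (lt_le_trans p2 h2); rewrite ltxx.
  by move: (lt_le_trans p1 h1); rewrite ltxx.
have arith (a b c d u v w z : R) : a + b = u + c -> u + d = v + z -> v <= w ->
    z = 0 -> d <= w - a - b + c by lra.
rewrite e3 in e1.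
exact: arith e1 e2 e4 e5.
Qed.

Lemma lisval_growth k (x x' y y' : R) : 0 <= x <= x' -> 0 <= y <= y' ->
  lisval k.+1 (x', y') + lisval k (x, y) <=
  Num.max (lisval k (x', y) + lisval k.+1 (x, y'))
          (lisval k.+1 (x', y) + lisval k (x, y')) +
  (massbox (x', y') - massbox (x', y) - massbox (x, y') + massbox (x, y)).
Proof.
move=> hx hy; have /andP[x0 xx] := hx; have /andP[y0 yy] := hy.
apply/ler_addgt0Pr => e e0; have e20 : 0 < e / 2 by lra.
have [A [AU Ab cA [P [ndP AP]]] hA] := lisval_adherent mu k.+1 (x', y') e20.
have [A' [AU' Ab' cA' kA']] := lisval_adherent mu k (x, y) e20.
have [Q [ndQ A'Q Q0]] := k_nondecreasing_pad kA'.
move=> hA'; pose C := vstrip x x' `&` hstrip y y'.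
have mC : measurable C.
  by apply: measurableI; [exact: measurable_vstrip|exact: measurable_hstrip].
have mA : measurable (A : set (plane R)) by exact: closed_measurable_plane.
have mA' : measurable (A' : set (plane R)) by exact: closed_measurable_plane.
pose P' i := P i `\` C.
have AC : A `\` C = \bigcup_i P' i.
  by rewrite AP setDE setI_bigcupl.
pose eps i := `[< exists2 p, P' i p & x < p.1 >].
have inb i p : P' i p -> p.1 <= x' /\ p.2 <= y'.
  move=> [Pp _]; have /Ab[/=] : A p by rewrite AP; exists i.
  by rewrite !in_itv/= => /andP[_ ->] /andP[_ ->].
have notC i p : P' i p -> p.1 <= x \/ p.2 <= y.
  move=> Pp; have [p1 p2] := inb _ _ Pp; case: Pp => _ nC.
  have [?|h1] := leP p.1 x; first by left.
  have [?|h2] := leP p.2 y; first by right.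
  by exfalso; apply: nC; split; rewrite /= /vstrip /hstrip/= ?h1 ?h2.
have [|||||||||||sg [lose [h1 h2 h3]]] := @exchange_mass R mu k P' Q x y x' y' eps.
- by move=> i p q [Pp _] [Pq _]; exact: ndP Pp Pq.
- exact: ndQ.
- by rewrite -AC; exact: measurableD.
- by rewrite -A'Q.
- exact: xx.
- exact: yy.
- by rewrite -AC => p [Ap _]; split; [exact: AU|exact: Ab].
- by rewrite -A'Q => p Ap; split; [exact: AU'|exact: Ab'].
- exact: notC.
- by move=> i p Pp px; apply/asboolP; exists p.
(* A point above the quadrant and one to its right, both outside the corner, are strictly oppositely
   ordered. *)
- move=> i p Pp py; apply/asboolP => -[q Pq qx].
  have [px|px] := notC _ _ Pp; last by move: (le_lt_trans px py); rewrite ltxx.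
  have [qx'|qy] := notC _ _ Pq; first by move: (le_lt_trans qx' qx); rewrite ltxx.
  have := ndP i p q Pp.1 Pq.1; apply/negP; rewrite -ltNge; nra.
have hC := corner_mass_le hx hy.
have hAC : mass A <= mass (A `\` C) + mass C.
  apply: mass_setU_le => //; first exact: measurableD.
  by move=> p Ap; have [?|?] := pselect (C p); [right|left].
rewrite -AC -A'Q in h1.
(* Slot [i0] is paired with the empty chain, so the family that does not continue [P' i0] has an
   empty slot; [eps i0] thus selects the term of the maximum. *)
have [i0 si0] : exists i, sg i = ord_max by exists ((sg^-1)%g ord_max); rewrite permKV.
suff : lisval (k.+1 - lose true) (x', y) + lisval (k.+1 - lose false) (x, y') <=
  Num.max (lisval k (x', y) + lisval k.+1 (x, y'))
          (lisval k.+1 (x', y) + lisval k (x, y')).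
  by rewrite -/C in hC; lra.
rewrite le_max; have := h3 (~~ eps i0) i0; rewrite si0 Q0.
case: (eps i0) => /= /(_ erefl) -> ; rewrite subn1/=; apply/orP.
  by right; rewrite lerD2r lisval_leB.
by left; rewrite lerD2l lisval_leB.
Qed.

(** This is monotonicity of [lambda] in [x]. The boxes have the same height, so the [k] chains of
    the larger one can leave the smaller only to the right. *)
Lemma lisval_shift_x k (x x' y : R) : x <= x' ->
  lisval k.+1 (x, y) + lisval k (x', y) <= lisval k.+1 (x', y) + lisval k (x, y).
Proof.
move=> xx.
apply/ler_addgt0Pr => e e0; have e20 : 0 < e / 2 by lra.
have [A [AU Ab cA [P [ndP AP]]] hA] := lisval_adherent mu k.+1 (x, y) e20.
have [A' [AU' Ab' cA' kA']] := lisval_adherent mu k (x', y) e20.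
have [Q [ndQ A'Q Q0]] := k_nondecreasing_pad kA'.
move=> hA'.
have inb i p : Q i p -> p.2 <= y.
  move=> Pp; have /Ab'[/=] : A' p by rewrite A'Q; exists i.
  by rewrite !in_itv/= => _ /andP[_ ->].
(* Every true chain of [Q] goes to the right family, and the empty one to the family of [(x, y)],
   which then needs only [k] chains. *)
have [|||||||||||sg [lose [h1 h2 h3]]] :=
    @exchange_mass R mu k Q P x y x' y (fun i => i != ord_max).
- exact: ndQ.
- exact: ndP.
- by rewrite -A'Q; exact: closed_measurable_plane.
- by rewrite -AP; exact: closed_measurable_plane.
- exact: xx.
- exact: lexx.
- by rewrite -A'Q => p Ap; split; [exact: AU'|exact: Ab'].
- by rewrite -AP => p Ap; split; [exact: AU|exact: Ab].
- by move=> i p Qp; right; exact: inb Qp.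
- by move=> i p Qp _; apply/eqP => h; move: Qp; rewrite h Q0.
- by move=> i p Qp py; have := inb _ _ Qp; rewrite leNgt py.
have := h3 false ord_max; rewrite eqxx/= Q0 => /(_ erefl) lf.
move: h1; rewrite lf subn1/= -A'Q -AP.
have := @lisval_leB k (lose true) (x', y) (h2 _); lra.
Qed.

Lemma lisval_shift_y k (x y y' : R) : y <= y' ->
  lisval k.+1 (x, y) + lisval k (x, y') <= lisval k.+1 (x, y') + lisval k (x, y).
Proof.
move=> yy.
apply/ler_addgt0Pr => e e0; have e20 : 0 < e / 2 by lra.
have [A [AU Ab cA [P [ndP AP]]] hA] := lisval_adherent mu k.+1 (x, y) e20.
have [A' [AU' Ab' cA' kA']] := lisval_adherent mu k (x, y') e20.
have [Q [ndQ A'Q Q0]] := k_nondecreasing_pad kA'.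
move=> hA'.
have inb i p : Q i p -> p.1 <= x.
  move=> Pp; have /Ab'[/=] : A' p by rewrite A'Q; exists i.
  by rewrite !in_itv/= => /andP[_ ->].
have [|||||||||||sg [lose [h1 h2 h3]]] :=
    @exchange_mass R mu k Q P x y x y' (fun i => i == ord_max).
- exact: ndQ.
- exact: ndP.
- by rewrite -A'Q; exact: closed_measurable_plane.
- by rewrite -AP; exact: closed_measurable_plane.
- exact: lexx.
- exact: yy.
- by rewrite -A'Q => p Ap; split; [exact: AU'|exact: Ab'].
- by rewrite -AP => p Ap; split; [exact: AU|exact: Ab].
- by move=> i p Qp; left; exact: inb Qp.
- by move=> i p Qp px; have := inb _ _ Qp; rewrite leNgt px.
- by move=> i p Qp _; apply/eqP => h; move: Qp; rewrite h Q0.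
have := h3 true ord_max; rewrite eqxx/= Q0 => /(_ erefl) lt.
move: h1; rewrite lt subn1/= -A'Q -AP.
have := @lisval_leB k (lose false) (x, y') (h2 _); lra.
Qed.
End LocalRules.

(** * Partial derivatives *)

Section Partials.
Context {R : realType}.
Implicit Types (f : R * R -> R) (p : R * R).

(** Uniformity in [s] and [t] lets one [d] serve all corners of a small square. *)
Lemma differentiable_partials f p : differentiable f p ->
  forall e, 0 < e -> \forall d \near (0 : R)^'+, forall s t, `|s| <= 1 -> `|t| <= 1 ->
    `|f (p.1 + d * s, p.2 + d * t) - f p -
      d * ('D_(1, 0) f p * s + 'D_(0, 1) f p * t)| <= e * d.
Proof.
move=> dfp e e0; have /diff_locally/eqaddoP df := dfp; rewrite !deriveE//.
have /nbhs_ballP[r /= r0 hr] := df _ e0.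
near=> d => s t s1 t1.
have d0 : 0 < d by near: d; exact: nbhs_right_gt.
have dr : d < r by near: d; exact: nbhs_right_lt.
have le_d u : `|u| <= 1 -> `|d * u| <= d by move=> ?; rewrite normrM (gtr0_norm d0) ler_piMr// ltW.
have nle : `|((d * s, d * t) : R * R)| <= d.
  have -> : `|((d * s, d * t) : R * R)| = Num.max `|d * s| `|d * t| by [].
  by rewrite ge_max !le_d.
have hb : ball (0 : R * R) r (d * s, d * t).
  by split; rewrite /ball/= sub0r normrN (le_lt_trans (le_d _ _) dr).
have H : `|f (p.1 + d * s, p.2 + d * t) - (f p + 'd f p (d * s, d * t))| <= e * d.
  rewrite [p.1 + _]addrC [p.2 + _]addrC.
  by apply: (le_trans (hr _ hb)); rewrite ler_pM2l.
have E : 'd f p (d * s, d * t) = d * ('d f p (1, 0) * s + 'd f p (0, 1) * t).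
  have -> : (d * s, d * t) = (d * s) *: ((1, 0) : R * R) + (d * t) *: ((0, 1) : R * R).
    by congr (_, _); rewrite /= /GRing.scale/= ?mulr0 ?mulr1 ?addr0 ?add0r.
  by rewrite linearD !linearZ/= /GRing.scale/=; lra.
by rewrite -E -addrA -opprD.
Unshelve. all: by end_near. Qed.

Lemma derive1_fst f p : derive1 (fun x => f (x, p.2)) p.1 = 'D_(1, 0) f p.
Proof.
rewrite /derive1 /derive; apply: (congr1 (fun F : R -> R => lim (F @ 0^'))); apply/funext => h /=.
congr (_ *: (f _ - f _)); last by case: p.
by congr (_, _); rewrite /= /GRing.scale/= ?mulr0 ?mulr1 ?add0r.
Qed.

Lemma derive1_snd f p : derive1 (fun y => f (p.1, y)) p.2 = 'D_(0, 1) f p.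
Proof.
rewrite /derive1 /derive; apply: (congr1 (fun F : R -> R => lim (F @ 0^'))); apply/funext => h /=.
congr (_ *: (f _ - f _)); last by case: p.
by congr (_, _); rewrite /= /GRing.scale/= ?mulr0 ?mulr1 ?add0r.
Qed.
(** To first order the terms in [g] and [m] cancel, leaving the sum of the partials of [f] at most
    their maximum. *)
Lemma partials_min_le0 (f g m : R * R -> R) (p : R * R) :
  differentiable f p -> differentiable g p -> differentiable m p ->
  (forall d, 0 < d ->
    f (p.1 + d, p.2 + d) + g (p.1 + d, p.2 + d) + g p <=
    g (p.1 + d, p.2) + g (p.1, p.2 + d) + Num.max (f (p.1 + d, p.2)) (f (p.1, p.2 + d)) +
    (m (p.1 + d, p.2 + d) - m (p.1 + d, p.2) - m (p.1, p.2 + d) + m p)) ->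
  Num.min ('D_(1, 0) f p) ('D_(0, 1) f p) <= 0.
Proof.
move=> df dg dm H; apply/ler_addgt0Pr => e e0; rewrite add0r.
(* At most eight estimates are added: two for [f], three for [g] and three for [m]. *)
have e9 : 0 < e / 9 by lra.
have d_gt0 : \forall d \near (0 : R)^'+, 0 < d by exact: nbhs_right_gt.
have [d [[Hf Hg] [Hm d0]]] := filter_ex (filterI
  (filterI (differentiable_partials df e9) (differentiable_partials dg e9))
  (filterI (differentiable_partials dm e9) d_gt0)).
have := H _ d0; move: Hf Hg Hm.
move: ('D_(1, 0) f p : R) ('D_(0, 1) f p : R) ('D_(1, 0) g p : R) ('D_(0, 1) g p : R).
move: ('D_(1, 0) m p : R) ('D_(0, 1) m p : R) => a b a1 b1 a2 b2 Hf Hg Hm.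
have n0 : `|0 : R| <= 1 by rewrite normr0.
have n1 : `|1 : R| <= 1 by rewrite normr1.
have := Hf 1 1 n1 n1; have := Hf 1 0 n1 n0; have := Hf 0 1 n0 n1.
have := Hg 1 1 n1 n1; have := Hg 1 0 n1 n0; have := Hg 0 1 n0 n1.
have := Hm 1 1 n1 n1; have := Hm 1 0 n1 n0; have := Hm 0 1 n0 n1.
rewrite !mulr1 !mulr0 !addr0 !add0r.
rewrite !ler_norml => /andP[? ?] /andP[? ?] /andP[? ?] /andP[? ?] /andP[? ?].
move=> /andP[? ?] /andP[? ?] /andP[? ?] /andP[? ?] h.
rewrite ge_min; apply/orP; move: h; case: (leP (f (p.1 + d, p.2))) => _ h.
  by left; rewrite -(ler_pM2l d0); lra.
by right; rewrite -(ler_pM2l d0); lra.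
Qed.

Lemma partial1_ge0 (f : R * R -> R) (p : R * R) : differentiable f p ->
  (forall d, 0 < d -> f p <= f (p.1 + d, p.2)) -> 0 <= 'D_(1, 0) f p.
Proof.
move=> df H; apply/ler_addgt0Pr => e e0.
have d_gt0 : \forall d \near (0 : R)^'+, 0 < d by exact: nbhs_right_gt.
have [d [Hf d0]] := filter_ex (filterI (differentiable_partials df e0) d_gt0).
have := Hf 1 0; rewrite normr0 normr1 => /(_ (lexx _) ler01).
rewrite !mulr1 !mulr0 !addr0 ler_norml => /andP[_].
by have := H _ d0; rewrite -(pmulr_rge0 _ d0); lra.
Qed.

Lemma partial2_ge0 (f : R * R -> R) (p : R * R) : differentiable f p ->
  (forall d, 0 < d -> f p <= f (p.1, p.2 + d)) -> 0 <= 'D_(0, 1) f p.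
Proof.
move=> df H; apply/ler_addgt0Pr => e e0.
have d_gt0 : \forall d \near (0 : R)^'+, 0 < d by exact: nbhs_right_gt.
have [d [Hf d0]] := filter_ex (filterI (differentiable_partials df e0) d_gt0).
have := Hf 0 1; rewrite normr0 normr1 => /(_ ler01 (lexx _)).
rewrite !mulr1 !mulr0 !addr0 !add0r ler_norml => /andP[_].
by have := H _ d0; rewrite -(pmulr_rge0 _ d0); lra.
Qed.

(** Subtracting [k10 + k01] from both terms of the maximum turns the growth rule into one for
    differences [l - k], the values of [lambda]. *)
Lemma growth_increments (l11 l10 l01 k11 k10 k01 k00 c : R) :
  l11 + k00 <= Num.max (k10 + l01) (l10 + k01) + c ->
  l11 - k11 + k11 + k00 <= k10 + k01 + Num.max (l10 - k10) (l01 - k01) + c.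
Proof.
have m1 : l10 - k10 <= Num.max (l10 - k10) (l01 - k01) by rewrite le_max lexx.
have m2 : l01 - k01 <= Num.max (l10 - k10) (l01 - k01) by rewrite le_max lexx orbT.
move: (Num.max (l10 - k10) _) m1 m2 => m m1 m2.
by rewrite -lerBlDr le_max => /orP[h|h]; lra.
Qed.

End Partials.

(** * Vanishing of the product of the partial derivatives *)

Section Main.
Context {R : realType} (mu : probability (plane R) R).

Lemma lambda_partials_mul0 k (p : R * R) : 0 < p.1 -> 0 < p.2 ->
  differentiable (lisval mu k.+1) p -> differentiable (lisval mu k) p ->
  differentiable (massbox mu) p ->
  differentiable (lambda mu k.+1) p /\
  'D_(1, 0) (lambda mu k.+1) p * 'D_(0, 1) (lambda mu k.+1) p = 0.
Proof.
move=> x0 y0 d1 d0 dm.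
have dl : differentiable (lambda mu k.+1) p.
  by rewrite -[lambda _ _]/(lisval mu k.+1 - lisval mu k); exact: differentiableB.
split => //.
have lE q : lambda mu k.+1 q = lisval mu k.+1 q - lisval mu k q by [].
have pE : p = (p.1, p.2) by case: (p).
have apos : 0 <= 'D_(1, 0) (lambda mu k.+1) p.
  apply: partial1_ge0 => // d dd; rewrite !lE {1 2}pE.
  by have := @lisval_shift_x _ mu k p.1 (p.1 + d) p.2; rewrite lerDl ltW// => /(_ isT); lra.
have bpos : 0 <= 'D_(0, 1) (lambda mu k.+1) p.
  apply: partial2_ge0 => // d dd; rewrite !lE {1 2}pE.
  by have := @lisval_shift_y _ mu k p.1 p.2 (p.2 + d); rewrite lerDl ltW// => /(_ isT); lra.
have := partials_min_le0 dl d0 dm; rewrite ge_min => /(_ _)/orP[d dd||].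
- rewrite !lE.
  have hx : 0 <= p.1 <= p.1 + d by rewrite lerDl !ltW.
  have hy : 0 <= p.2 <= p.2 + d by rewrite lerDl !ltW.
  have := @lisval_growth _ mu k _ _ _ _ hx hy; rewrite -pE.
  exact: growth_increments.
- by move=> h; have /eqP -> : 'D_(1, 0) (lambda mu k.+1) p == 0; rewrite ?mul0r// eq_le h apos.
- by move=> h; have /eqP -> : 'D_(0, 1) (lambda mu k.+1) p == 0; rewrite ?mulr0// eq_le h bpos.
Qed.

End Main.

Theorem corollary2p11 (R : realType) (mu : probability (plane R) R)
    (r : nat) (hmu : is_permuton mu) (hr : (1 <= r)%N) (hLIS : LIS r mu = 1%E) :
  forall k : nat, (1 <= k <= r)%N ->
  {ae (lebesgue_measure \x lebesgue_measure)%E, forall p : R * R,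
    0 < p.1 < 1 -> 0 < p.2 < 1 ->
    differentiable (lambda mu k) p /\
    derive1 (fun x : R => lambda mu k (x, p.2)) p.1 *
    derive1 (fun y : R => lambda mu k (p.1, y)) p.2 = 0}.
Proof.
move=> [//|k] _.
have D1 := ae_differentiable_monotone_nonexpansive (lisval_monotone_nonexpansive hmu k.+1).
have D0 := ae_differentiable_monotone_nonexpansive (lisval_monotone_nonexpansive hmu k).
have DM := ae_differentiable_monotone_nonexpansive (massbox_monotone_nonexpansive hmu).
apply: (@filterS3 _ _ (ae_filter_ringOfSetsType
  (@lebesgue_measure R \x @lebesgue_measure R)%E) _ _ _ _ _ D1 D0 DM).
move=> p d1 d0 dM /andP[x0 _] /andP[y0 _].
rewrite (derive1_fst (lambda mu k.+1)) (derive1_snd (lambda mu k.+1)).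
exact: lambda_partials_mul0.
Qed.
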